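(* Let $\beta_0$ be a smooth basis set of monomials in the $r-1$ variables $x_1,\dots,x_{r-1}$, and let $w_r$ be a positive integer. Then the thickening $\beta=\{\mathbf x^{\mathbf j_0}x_r^s : \mathbf x^{\mathbf j_0}\in\beta_0,\ 0\le s\le w_r-1\}$ is a smooth basis set in the variables $x_1,\dots,x_r$.
   Context: $k$ is an algebraically closed field. A basis set in variables $x_1,\dots,x_m$ is a finite nonempty set $\beta$ of monomials in these variables closed under taking divisors; $I_\beta\subseteq k[x_1,\dots,x_m]$ is the ideal generated by monomials not in $\beta$, of colength $|\beta|$. Such $\beta$ is smooth if the point corresponding to $I_\beta$ is a nonsingular point of the Hilbert scheme of $|\beta|$ points of $\mathbb A^m_k$. *)

(* Defs.v *)
From HB Require Import structures.
From mathcomp Require Import all_boot all_order all_algebra.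
From mathcomp Require Import finmap.
From mathcomp Require Import mpoly.

Set Implicit Arguments.
Unset Strict Implicit.
Unset Printing Implicit Defensive.

Import GRing.Theory.
Local Open Scope ring_scope.


(* Basic affine algebraic geometry over a field k: a closed subscheme  *)
(* X = V(F) of A^N_k given by a finite list F of polynomials, and a    *)
(* k-rational point p of X.                                            *)

Section AffineGeometry.
Variables (k : fieldType) (N : nat).
Local Notation R := {mpoly k[N]}.

Definition is_ideal (P : R -> Prop) : Prop :=
  [/\ P 0, (forall x y, P x -> P y -> P (x + y)) & (forall a x, P x -> P (a * x))].

Definition is_prime_ideal (P : R -> Prop) : Prop :=
  [/\ is_ideal P, ~ P 1 & forall x y, P (x * y) -> P x \/ P y].

Definition max_ideal (p : 'I_N -> k) : R -> Prop := fun f => f.@[p] = 0.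

(* a chain of primes P_0 < P_1 < ... < P_d with (F) <= P_0 and P_d <= m_p;
   these are exactly the chains of primes of the local ring O_{X,p}     *)
Definition prime_chain_at (F : seq R) (p : 'I_N -> k) (d : nat) : Prop :=
  exists c : nat -> (R -> Prop),
    [/\ forall j, (j <= d)%N -> is_prime_ideal (c j),
        forall j, (j < d)%N ->
          (forall f, c j f -> c j.+1 f) /\ exists f, c j.+1 f /\ ~ c j f,
        forall f, f \in F -> c 0%N f
      & forall f, c d f -> max_ideal p f].

Definition local_dim_is (F : seq R) (p : 'I_N -> k) (d : nat) : Prop :=
  prime_chain_at F p d /\ ~ prime_chain_at F p d.+1.

Definition jacobian_at (F : seq R) (p : 'I_N -> k) : 'M[k]_(size F, N) :=
  \matrix_(r < size F, i < N) ((mderiv i (nth 0 F r)).@[p]).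

Definition tangent_dim (F : seq R) (p : 'I_N -> k) : nat :=
  (N - \rank (jacobian_at F p))%N.

Definition nonsingular_at (F : seq R) (p : 'I_N -> k) : Prop :=
  local_dim_is F p (tangent_dim F p).

End AffineGeometry.

Definition basis_set (m : nat) (beta : {fset 'X_{1..m}}) : Prop :=
  beta != fset0%fset /\
  forall a b : 'X_{1..m}, a \in beta -> (b <= a)%MM -> b \in beta.

(* The standard open affine chart U_beta of Hilb^n(A^m_k), n = |beta|:  *)
(* the ideals I such that beta is a k-basis of k[x]/I.  It is the       *)
(* closed subscheme of A^(m n^2) (entries of m matrices M_1..M_m of     *)
(* multiplication by x_i in the basis beta) cut out by                  *)
(*   M_i M_j = M_j M_i   and   x^b(M) e_1 = e_b  for all b in beta.     *)
(* The point I_beta is given by M_i e_b = e_{b x_i} (or 0 if b x_i is   *)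
(* not in beta).                                                        *)

Section HilbChart.
Variables (k : fieldType) (m : nat) (beta : {fset 'X_{1..m}}).

Definition hb_n : nat := #|{: beta}|.
Definition hb_V : finType := ('I_m * 'I_hb_n * 'I_hb_n)%type.
Definition hb_N : nat := #|{: hb_V}|.

Definition hb_mon (a : 'I_hb_n) : 'X_{1..m} := val (enum_val a).

Definition hb_var (i : 'I_m) (a b : 'I_hb_n) : {mpoly k[hb_N]} :=
  'X_(enum_rank ((i, a, b) : hb_V)).

Definition hb_mat (i : 'I_m) : 'M[{mpoly k[hb_N]}]_hb_n :=
  \matrix_(a, b) hb_var i a b.

Definition hb_matmon (e : 'X_{1..m}) : 'M[{mpoly k[hb_N]}]_hb_n :=
  \prod_(i < m) (hb_mat i) ^+ (e i).

Definition hb_e1 : 'cV[{mpoly k[hb_N]}]_hb_n :=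
  \col_a ((hb_mon a == 0%MM)%:R).

Definition hb_equations : seq {mpoly k[hb_N]} :=
  [seq (hb_mat ij.1 *m hb_mat ij.2 - hb_mat ij.2 *m hb_mat ij.1) ab.1 ab.2
     | ij <- enum {: 'I_m * 'I_m}, ab <- enum {: 'I_hb_n * 'I_hb_n}]
  ++
  [seq (hb_matmon (hb_mon b) *m hb_e1 - delta_mx b 0) a 0
     | b <- enum {: 'I_hb_n}, a <- enum {: 'I_hb_n}].

Definition hb_point (v : 'I_hb_N) : k :=
  let: (i, a, b) := enum_val v in
  ((hb_mon b + U_(i))%MM == hb_mon a)%:R.

End HilbChart.

Arguments hb_equations k {m} beta.
Arguments hb_point k {m} beta.

(* beta is smooth: I_beta is a nonsingular point of Hilb^{|beta|}(A^m_k) *)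
Definition smooth_basis_set (k : fieldType) (m : nat) (beta : {fset 'X_{1..m}}) : Prop :=
  nonsingular_at (hb_equations k beta) (hb_point k beta).

Definition mnm_front (m : nat) (c : 'X_{1..m.+1}) : 'X_{1..m} :=
  [multinom c (widen_ord (leqnSn m) j) | j < m].

(* Main.v *)
Require Import Defs.
From HB Require Import structures.
From mathcomp Require Import all_boot all_order all_algebra.
From mathcomp Require Import finmap.
From mathcomp Require Import mpoly.
From mathcomp Require Import generic_quotient ring_quotient ring.
From Stdlib Require Import Classical ClassicalEpsilon.

(** Write n = |beta|, n0 = |beta0|, let t, t0 be the dimensions of the tangent spaces at
    I_beta and I_beta0, and let m be the number of variables of beta0.

    A tangent vector at I_beta is a k[x,y]-linear map I_beta -> k[x,y]/I_beta, and I_beta is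
    generated by I_beta0 and y^w, so it is determined by the w components (along the powers
    of y) of its restriction to I_beta0 and by its value on y^w: t <= w t0 + w n0.

    Distracting monomials and moving the resulting points apart gives a curve through any
    monomial point whose general member is an algebra generated by one linear coordinate.
    Such algebras are parametrized birationally by affine space of dimension (number of
    variables) * n (a companion matrix and polynomials in it).  Freeing these parameters one
    at a time, starting from the curve, gives a chain of primes of that length at I_beta.

    Chains of primes of the local ring at a point have length at most the dimension of the
    tangent space: by Artin-Rees, elements separating the primes have monomials that stay
    linearly independent modulo linearly growing powers of the maximal ideal, while the
    tangent space bounds the Hilbert function.  If equality holds, the bottom of the chain is
    contained in every prime of the local ring; so for smooth beta0 it lies below the curve,
    its residue field is generated by the m n0 parameters above, and t0 <= m n0.

    Hence t <= w m n0 + w n0 = (m + 1) n, and the chain of length (m + 1) n at I_beta forces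
    equality. *)

Set Implicit Arguments.
Unset Strict Implicit.
Unset Printing Implicit Defensive.

Import Order.TTheory GRing.Theory.

(** * Powers of a maximal ideal and Artin-Rees *)

(** Nonsingularity is stated through chains of primes and the Jacobian rank only, so dimensions are
    compared by counting: a chain of length d forces n^d classes to be independent modulo P_0 and
    the power C n of the maximal ideal, while t tangent coordinates supply at most (C n)^t
    monomials. Constants such as C do not matter, since only the exponents of n are compared.

    The obstacle is that a Hilbert scheme can have components of several dimensions. The equality of
    t0 with the length of some chain gives no numerical value by itself, because that chain might
    lie away from the component of the companion parameters. The refined count, in which one extra
    relation costs a whole power of n, forces the bottom of the chain below the curve, where the
    Krylov determinant is nonzero.

    The curve is a point over k(s) with a value at s = 0. Its eigenvalues are sums of distinct
    powers of s, so that they are distinct over every field k. *)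

Section Dickson.

Let le_seq (s t : seq nat) := forall i, (nth 0 s i <= nth 0 t i)%N.

(** Induction on the length. Finitely many tails dominate all tails, and [J] bounds the heads that
    go with them: a sequence with head at least [J] lies above one of these witnesses, and the
    finitely many smaller heads are treated slice by slice. *)
Let dickson_seq n (A : seq nat -> Prop) :
  (forall s, A s -> size s = n) ->
  exists l : seq (seq nat), (forall s, s \in l -> A s) /\
    forall s, A s -> exists2 t, t \in l & le_seq t s.
Proof.
elim: n A => [|n IH] A sizeA.
  case: (classic (A [::])) => [A0|nA0].
    exists [:: [::]]; split=> [s|s As]; first by rewrite inE => /eqP ->.
    by exists [::]; rewrite ?inE //; have /size0nil -> := sizeA _ As.
  exists [::]; split=> // s As; case: nA0; by have /size0nil <- := sizeA _ As.
have sizeB (C : nat -> Prop) s : (exists2 j, C j & A (j :: s)) -> size s = n.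
  by case=> j _ /sizeA [].
have [l [lB lP]] := IH _ (sizeB (fun=> True)).
have [J JP] : exists J, forall s, s \in l -> exists2 j, (j <= J)%N & A (j :: s).
  elim: l lB {lP} => [|s l IHl] lB; first by exists 0%N.
  have [|J JP] := IHl; first by move=> t tl; apply: lB; rewrite inE tl orbT.
  have [j _ Aj] := lB s (mem_head _ _).
  exists (maxn j J) => t; rewrite inE => /orP[/eqP ->|/JP[i iJ Ai]].
    by exists j; rewrite // leq_maxl.
  by exists i; rewrite // leq_max iJ orbT.
have cut K : exists l : seq (seq nat), (forall s, s \in l -> A s) /\
    forall j s, (j < K)%N -> A (j :: s) -> exists2 t, t \in l & le_seq t (j :: s).
  elim: K => [|K [l1 [l1A l1P]]]; first by exists [::]; split.
  have [l2 [l2A l2P]] := IH _ (sizeB (eq K)).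
  exists (l1 ++ map (cons K) l2); split=> [s|j s].
    rewrite mem_cat => /orP[/l1A //|/mapP[t /l2A[j <- Aj] ->]] //.
  rewrite ltnS leq_eqVlt => /orP[/eqP -> As|jK As].
    have [|t tl ts] := l2P s; first by exists K.
    exists (K :: t); first by rewrite mem_cat map_f ?orbT.
    by case=> [|i] //=.
  by have [t tl ts] := l1P _ _ jK As; exists t; rewrite // mem_cat tl.
have [l2 [l2A l2P]] := cut J.
have [l3 [l3A l3P]] : exists l3 : seq (seq nat), (forall s, s \in l3 -> A s) /\
    forall s, s \in l -> exists2 j, (j <= J)%N & (j :: s) \in l3.
  elim: l JP {lB lP} => [|s l IHl] JP; first by exists [::]; split.
  have [|l3 [l3A l3P]] := IHl; first by move=> t tl; apply: JP; rewrite inE tl orbT.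
  have [j jJ Aj] := JP s (mem_head _ _).
  exists ((j :: s) :: l3); split=> [t|t].
    by rewrite inE => /orP[/eqP ->|/l3A].
  rewrite inE => /orP[/eqP ->|/l3P[i iJ Ai]]; first by exists j; rewrite ?inE ?eqxx.
  by exists i; rewrite // inE Ai orbT.
exists (l2 ++ l3); split=> [s|s As].
  by rewrite mem_cat => /orP[/l2A|/l3A].
case: s As => [|j s] As; first by have := sizeA _ As.
have [jJ|Jj] := ltnP j J.
  by have [t tl ts] := l2P _ _ jJ As; exists t; rewrite // mem_cat tl.
have [|t tl ts] := lP s; first by exists j.
have [i iJ il] := l3P _ tl.
exists (i :: t); first by rewrite mem_cat il orbT.
by case=> [|k] /=; [exact: leq_trans iJ Jj | exact: ts].
Qed.

Lemma dickson n (A : 'X_{1..n} -> Prop) :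
  exists l : seq 'X_{1..n}, (forall m, m \in l -> A m) /\
    forall m, A m -> exists2 m', m' \in l & (m' <= m)%MM.
Proof.
pose B (s : seq nat) := exists2 m : 'X_{1..n}, A m & s = m :> seq nat.
have [|l [lB lP]] := @dickson_seq n B; first by move=> s [m _ ->]; rewrite size_tuple.
have toA : exists l' : seq 'X_{1..n}, (forall m, m \in l' -> A m) /\
    forall s, s \in l -> exists2 m : 'X_{1..n}, m \in l' & s = m :> seq nat.
  elim: l lB {lP} => [|s l IHl] lB; first by exists [::]; split.
  have [|l' [lA lP]] := IHl; first by move=> t tl; apply: lB; rewrite inE tl orbT.
  have [m Am sm] := lB s (mem_head _ _).
  exists (m :: l'); split=> [t|t].
    by rewrite inE => /orP[/eqP ->|/lA].
  rewrite inE => /orP[/eqP ->|/lP[u ul ->]]; first by exists m; rewrite ?inE ?eqxx.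
  by exists u; rewrite // inE ul orbT.
have [l' [lA lQ]] := toA.
exists l'; split=> // m Am.
have [|s sl le_sm] := lP (m : seq nat); first by exists m.
have [m' ml' sm'] := lQ _ sl; exists m' => //.
by apply/mnm_lepP => i; rewrite !(mnm_nth 0) -sm'; apply: le_sm.
Qed.

End Dickson.

Section PowersOfMaximalIdeal.
Local Open Scope ring_scope.
Variables (k : fieldType) (N : nat) (p : 'I_N -> k).
Local Notation R := {mpoly k[N]}.

Definition xshift i : R := 'X_i - (p i)%:MP.

(* The [n]-th power of the maximal ideal of [p]. *)
Fixpoint mpow n (f : R) : Prop :=
  if n is n'.+1 then
    exists2 g : 'I_N -> R, forall i, mpow n' (g i) & f = \sum_i g i * xshift i
  else True.

Lemma mpow0 n : mpow n 0.
Proof.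
by elim: n => [|n IH] //=; exists (fun=> 0) => //; rewrite big1 // => i _; rewrite mul0r.
Qed.

Lemma mpowD n f g : mpow n f -> mpow n g -> mpow n (f + g).
Proof.
elim: n f g => [|n IH] f g //= [u uP ->] [v vP ->].
exists (fun i => u i + v i) => [i|]; first exact: IH.
by rewrite -big_split /=; apply: eq_bigr => i _; rewrite mulrDl.
Qed.

Lemma mpowMl n a f : mpow n f -> mpow n (a * f).
Proof.
elim: n f => [|n IH] f //= [u uP ->].
exists (fun i => a * u i) => [i|]; first exact: IH.
by rewrite mulr_sumr; apply: eq_bigr => i _; rewrite mulrA.
Qed.

Lemma mpowN n f : mpow n f -> mpow n (- f).
Proof. by rewrite -mulN1r; apply: mpowMl. Qed.

Lemma mpowZ n c f : mpow n f -> mpow n (c *: f).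
Proof. by rewrite -mul_mpolyC; apply: mpowMl. Qed.

Lemma mpow_sum n (I : Type) (r : seq I) (Q : pred I) (F : I -> R) :
  (forall i, Q i -> mpow n (F i)) -> mpow n (\sum_(i <- r | Q i) F i).
Proof.
by move=> FP; apply: (big_ind (mpow n)) => //; [apply: mpow0|apply: mpowD].
Qed.

Lemma mpowS n f : mpow n.+1 f -> mpow n f.
Proof.
elim: n f => [|n IH] f //= [u uP ->].
by exists u => // i; apply: IH; apply: uP.
Qed.

Lemma mpow_leq n n' f : (n <= n')%N -> mpow n' f -> mpow n f.
Proof.
move=> /subnK <-; elim: (n' - n)%N => [|d IH] //.
by rewrite addSn => /mpowS /IH.
Qed.

Lemma mpow_mulx n f i : mpow n f -> mpow n.+1 (f * xshift i).
Proof.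
move=> fn /=; exists (fun j => if j == i then f else 0).
  by move=> j; case: eqP => // _; apply: mpow0.
rewrite (bigD1 i) //= eqxx big1 ?addr0 // => j /negPf ->.
by rewrite mul0r.
Qed.

Lemma mpowM a b f g : mpow a f -> mpow b g -> mpow (a + b) (f * g).
Proof.
elim: a f => [|a IH] f; first by move=> _; apply: mpowMl.
rewrite addSn => -[u uP ->] gb; rewrite mulr_suml.
by apply: mpow_sum => i _; rewrite mulrAC; apply: mpow_mulx (IH _ (uP i) gb).
Qed.

Lemma mpowX n f : mpow 1 f -> mpow n (f ^+ n).
Proof.
by move=> f1; elim: n => [|n IH] //; rewrite exprS -add1n; apply: mpowM.
Qed.

Lemma mpow_mon t (tau : 'I_t -> R) (m : 'X_{1..t}) :
  (forall i, mpow 1 (tau i)) -> mpow (mdeg m) (mmap1 tau m).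
Proof.
move=> tau1; rewrite mdegE /mmap1.
apply: (big_ind2 (fun d f => mpow d f)) => //; first by move=> *; apply: mpowM.
by move=> i _; apply: mpowX.
Qed.

Lemma mpow1_xshift i : mpow 1 (xshift i).
Proof. by rewrite -[xshift i]mul1r; apply: mpow_mulx. Qed.

Lemma mpow1_sub f : mpow 1 (f - (f.@[p])%:MP).
Proof.
elim/mpolyind: f => [|c m f _ _ IH]; first by rewrite meval0 subrr; apply: mpow0.
rewrite mevalD mpolyCD opprD addrACA; apply: mpowD => //.
rewrite mevalZ mpolyCM mul_mpolyC -scalerBr; apply: mpowZ.
rewrite mevalX mpolyXE_id.
pose K (a : R) (b : k) := mpow 1 (a - b%:MP).
have KM a b a1 b1 : K a b -> K a1 b1 -> K (a * a1) (b * b1).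
  rewrite /K mpolyCM => ab ab1.
  have -> : a * a1 - b%:MP * b1%:MP = a * (a1 - b1%:MP) + b1%:MP * (a - b%:MP).
    by rewrite !mulrBr addrA (mulrC b1%:MP a) subrK (mulrC b1%:MP).
  by apply: mpowD; apply: mpowMl.
have K1 : K 1 1 by rewrite /K mpolyC1 subrr; apply: mpow0.
apply: (big_ind2 K) => // i _; elim: (m i) => [|n IHn] //.
by rewrite !exprS; apply: KM => //; apply: mpow1_xshift.
Qed.

Lemma mpow1P f : mpow 1 f <-> f.@[p] = 0.
Proof.
split=> [[u _ ->]|f0]; last by have := mpow1_sub f; rewrite f0 mpolyC0 subr0.
rewrite rmorph_sum big1 //= => i _.
by rewrite mevalM mevalB mevalXU mevalC subrr mulr0.
Qed.

Section ArtinRees.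

(* The Rees algebra of [m_p] is presented by polynomials in [x_i] (first [N] variables)
   and [z_i] (last [N] variables), [z_i] standing for [x_i - p_i] in degree one. *)
Local Notation S := {mpoly k[N + N]}.

Let phi : {rmorphism S -> R} :=
  mmap (@mpolyC N k) (fun i => match split i with inl j => 'X_j | inr j => xshift j end).

Let phiC c : phi c%:MP = c%:MP.
Proof. exact: mmapC. Qed.

Let phil i : phi 'X_(lshift N i) = 'X_i.
Proof. by rewrite /phi /= mmapX mmap1U -/(unsplit (inl i)) unsplitK. Qed.

Let phir i : phi 'X_(rshift N i) = xshift i.
Proof. by rewrite /phi /= mmapX mmap1U -/(unsplit (inr i)) unsplitK. Qed.

Let zdeg (m : 'X_{1..N + N}) := (\sum_(i < N) m (rshift N i))%N.

Let zhom n (s : S) := forall m, m \in msupp s -> zdeg m = n.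

Let zdegD a b : zdeg (a + b)%MM = (zdeg a + zdeg b)%N.
Proof. by rewrite /zdeg -big_split; apply: eq_bigr => i _; rewrite mnmDE. Qed.

Let zhomD n s t : zhom n s -> zhom n t -> zhom n (s + t).
Proof. by move=> sn tn m /msuppD_le; rewrite mem_cat => /orP[/sn|/tn]. Qed.

Let zhom0 n : zhom n 0.
Proof. by move=> m; rewrite msupp0. Qed.

Let zhom_mulX n a s m : zhom n s -> zhom (zdeg m + n) (a *: ('X_[m] * s)).
Proof.
move=> sn m' /msuppZ_le; rewrite mulrC (perm_mem (msuppMX _ _)) => /mapP[m'' /sn <- ->].
by rewrite zdegD.
Qed.

Let phi_mon m : mpow (zdeg m) (phi 'X_[m]).
Proof.
rewrite /phi /= mmapX /mmap1 big_split_ord /=; apply: mpowMl.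
rewrite /zdeg; apply: (big_ind2 (fun d f => mpow d f)) => //; first by move=> *; apply: mpowM.
move=> i _; rewrite -/(unsplit (inr i)) unsplitK; apply: mpowX; exact: mpow1_xshift.
Qed.

Let phi_lift n f : mpow n f -> exists2 s, zhom n s & phi s = f.
Proof.
elim: n f => [|n IH] f /=.
  move=> _; exists (mmap (@mpolyC (N + N) k) (fun i => 'X_(lshift N i)) f).
    elim/mpolyind: f => [|c m f _ _ IH]; first by rewrite mmap0.
    rewrite mmapD; apply: zhomD => //; rewrite mmapZ mmapX mul_mpolyC.
    rewrite /mmap1 mprodXnE => m' /msuppZ_le /mem_msuppXP <-.
    rewrite /zdeg big1 // => i _; rewrite mnm_sumE big1 // => j _.
    by rewrite mulmnE mnm1E eq_lrshift.
  elim/mpolyind: f => [|c m f _ _ IH]; first by rewrite !raddf0.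
  rewrite mmapD rmorphD -[in RHS]IH mmapZ mmapX rmorphM; congr (_ + _).
  rewrite phiC mul_mpolyC; congr (_ *: _); rewrite /mmap1 rmorph_prod mpolyXE_id; apply: eq_bigr => i _.
  by rewrite rmorphXn phil.
case=> g gn ->.
have [s sP] : exists s : 'I_N -> S, forall i, zhom n (s i) /\ phi (s i) = g i.
  by apply: (choice (fun i s => zhom n s /\ phi s = g i)) => i; have [s] := IH _ (gn i); exists s.
exists (\sum_i 'X_(rshift N i) * s i).
  apply: (big_ind (zhom n.+1)) => // [|i _]; first exact: zhomD.
  have := @zhom_mulX n 1 (s i) U_(rshift N i)%MM (sP i).1.
  rewrite scale1r /zdeg (bigD1 i) //= mnm1E eqxx big1 ?addn0 // => j ji.
  by rewrite mnm1E eq_rshift eq_sym (negPf ji).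
by rewrite rmorph_sum; apply: eq_bigr => i _; rewrite rmorphM (sP i).2 mulrC phir.
Qed.

(** In the presented Rees algebra, take the elements homogeneous in the z-variables that map into P
    + (f). By Dickson, finitely many of them have leading monomials dividing all the others; [c]
    bounds their z-degrees. Dividing a lift of [f * a - g] by them leaves quotients of z-degree at
    least n, so its image is f times some b in the n-th power of the maximal ideal, modulo P.
    Primality then cancels f from f (a - b). *)
Lemma artin_rees (P : R -> Prop) f : is_prime_ideal P -> ~ P f ->
  exists c, forall n a, (exists2 g, P g & mpow (n + c) (f * a - g)) ->
    exists2 g, P g & mpow n (a - g).
Proof.
move=> [[P0 PD PM] P1 PP] nPf.
have PB x y : P x -> P y -> P (x - y).
  by move=> Px Py; apply: PD => //; rewrite -mulN1r; apply: PM.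
pose I s := exists a, P (phi s - f * a).
pose L m := exists n s, [/\ zhom n s, I s, s != 0 & mlead s = m].
have [l [lL lP]] := dickson L.
have [c cP] : exists c, forall m, m \in l ->
    exists n s, [/\ (n <= c)%N, zhom n s, I s & s != 0 /\ mlead s = m].
  elim: l lL {lP} => [|m l IHl] lL; first by exists 0%N.
  have [|c cP] := IHl; first by move=> t tl; apply: lL; rewrite inE tl orbT.
  have [n [s [sn sI s0 sm]]] := lL m (mem_head _ _).
  exists (maxn n c) => m'; rewrite inE => /orP[/eqP ->|/cP[n' [s' [le_n' ? ? ?]]]].
    by exists n, s; rewrite leq_maxl.
  by exists n', s'; rewrite leq_max le_n' orbT.
exists c => n.
have key m : forall s, zhom (n + c) s -> I s -> s != 0 -> mlead s = m ->
    exists2 b, mpow n b & P (phi s - f * b).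
  elim/(ltmwf (n := N + N)): m => m IH s sn [a Pa] s0 sm.
  have [|m' /cP[n' [s' [le_n' s'n [a' Pa'] [s'0 s'm]]]] le_m'] := lP m.
    by exists (n + c)%N, s; split=> //; exists a.
  pose u := (m - m')%MM.
  have us : (u + m')%MM = m by rewrite /u submK.
  have zu : (zdeg u + n' = n + c)%N.
    rewrite -(sn _ (mlead_supp s0)) sm -us zdegD; congr (_ + _)%N.
    by rewrite -s'm (s'n _ (mlead_supp s'0)).
  pose q := (mleadc s / mleadc s').
  have s'c : mleadc s' != 0 by rewrite mleadc_eq0.
  have q0 : q != 0 by rewrite mulf_neq0 ?invr_eq0 ?mleadc_eq0.
  pose v := q *: ('X_[u] * s').
  have X0 : 'X_[u] != 0 :> S.
    by rewrite -msupp_eq0 msuppX.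
  have vm : mlead v = m by rewrite mleadZ // mleadM ?mleadXm ?s'm.
  have vP : P (phi v - f * (phi (q *: 'X_[u]) * a')).
    rewrite /v scalerAl rmorphM mulrCA -mulrBr; exact: PM.
  have vn : mpow n (phi (q *: 'X_[u]) * a').
    rewrite /phi /= mmapZ -mulrA; apply: mpowMl; rewrite mulrC; apply: mpowMl.
    apply: (mpow_leq _ (phi_mon u)); rewrite -(leq_add2r n') zu leq_add2l //.
  pose w := s - v.
  have wn : zhom (n + c) w.
    by rewrite /w /v -scaleNr; apply: zhomD => //; rewrite -zu; apply: zhom_mulX.
  have sv : phi s = phi w + phi v by rewrite -rmorphD subrK.
  have wI : I w.
    exists (a - phi (q *: 'X_[u]) * a').
    have -> : phi w = phi s - phi v by rewrite sv addrK.
    by rewrite mulrBr opprD addrACA -opprD; apply: PB.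
  have [w0|w0] := eqVneq w 0.
    exists (phi (q *: 'X_[u]) * a') => //.
    by rewrite sv w0 rmorph0 add0r.
  have [|b bn bP] := IH (mlead w) _ w wn wI w0 erefl.
    rewrite lt_neqAle; apply/andP; split.
      apply/eqP => wm; move/negP: w0; apply; rewrite -mleadc_eq0 wm.
      have vc : v@_m = q * mleadc s'.
        by rewrite /v mcoeffZ -us s'm ['X_[u] * s']mulrC mcoeffMX.
      by rewrite /w mcoeffB vc -{1}sm /q divfK // subrr.
    apply: le_trans (mleadB_le _ _) _.
    by rewrite vm sm leUx lexx.
  exists (b + phi (q *: 'X_[u]) * a'); first exact: mpowD.
  rewrite sv mulrDr opprD addrACA; exact: PD.
move=> a [g Pg] /phi_lift[s sn Es].
have P0' : P (phi s - f * a + g) by rewrite Es addrAC subrK subrr.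
have Pa : P (phi s - f * a) by rewrite -[_ - _](addrK g); apply: PB.
have Is : I s by exists a.
have [b nb Pb] : exists2 b, mpow n b & P (phi s - f * b).
  have [s0|s0] := eqVneq s 0; last exact: key s0 erefl.
  by exists 0; [apply: mpow0 | rewrite s0 rmorph0 mulr0 subr0].
exists (a - b); last by rewrite opprB addrC subrK.
have /PP[] // : P (f * (a - b)).
have -> : f * (a - b) = (phi s - f * b) - (phi s - f * a).
  by rewrite mulrBr opprB [RHS]addrC addrA subrK.
exact: PB.
Qed.

End ArtinRees.
End PowersOfMaximalIdeal.

(** * Chains of primes and the tangent space *)

Section IndependenceModulo.
Local Open Scope ring_scope.
Variables (k : fieldType) (V : lmodType k) (Q : V -> Prop).

Definition indep_mod (T : finType) (u : T -> V) :=
  forall a : T -> k, Q (\sum_t a t *: u t) -> forall t, a t = 0.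

Hypotheses (QD : forall x y, Q x -> Q y -> Q (x + y)) (QZ : forall a x, Q x -> Q (a *: x)).

(** Writing each [u t] in terms of the [v s] modulo [Q] gives a matrix whose left kernel consists of
    relations among the [u t] modulo [Q], hence is zero. *)
Lemma indep_span_card (T S : finType) (u : T -> V) (v : S -> V) :
  Q 0 -> indep_mod u -> (forall t, exists b : S -> k, Q (u t - \sum_s b s *: v s)) ->
  (#|T| <= #|S|)%N.
Proof.
move=> Q0 ind /choice[b bP].
pose M : 'M[k]_(#|T|, #|S|) := \matrix_(i, j) b (enum_val i) (enum_val j).
suff /eqP <- : row_free M by apply: rank_leq_col.
apply: inj_row_free => x xM; apply/rowP => i; rewrite mxE.
pose a t := x 0 (enum_rank t).
suff a0 t : a t = 0 by rewrite -(enum_valK i); apply: a0.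
apply: ind.
have -> : \sum_t a t *: u t = \sum_t a t *: (u t - \sum_s b t s *: v s).
  apply/eqP; rewrite -subr_eq0 -sumrB; apply/eqP.
  under eq_bigr do rewrite -scalerBr opprB addrC subrK scaler_sumr.
  rewrite exchange_big big1 // => s _ /=.
  under eq_bigr do rewrite scalerA; rewrite -scaler_suml.
  have /matrixP/(_ 0 (enum_rank s)) := xM; rewrite !mxE => E.
  rewrite (reindex_onto enum_val enum_rank) /=; last by move=> ? _; apply: enum_rankK.
  suff -> : \sum_(j | enum_rank (enum_val j : T) == j) a (enum_val j) * b (enum_val j) s = 0.
    by rewrite scale0r.
  rewrite -[RHS]E; apply: eq_big => j.
    by rewrite enum_valK eqxx.
  by rewrite mxE enum_rankK /a enum_valK.
by apply: (big_ind Q) => // t' _; apply: QZ.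
Qed.

End IndependenceModulo.

Fixpoint box (d n : nat) : finType :=
  if d is d'.+1 then ('I_n * box d' n)%type else unit.

Lemma card_box d n : #|box d n| = (n ^ d)%N.
Proof.
elim: d => [|d IH] /=; first by rewrite card_unit.
by rewrite card_prod card_ord IH expnS.
Qed.

(* The monomial in [f 0, ..., f d.-1] with exponent vector in the box [0, n)^d. *)
Fixpoint boxmon (A : comNzRingType) (d n : nat) : (nat -> A) -> box d n -> A :=
  match d return (nat -> A) -> box d n -> A with
  | 0 => fun _ _ => 1%R
  | d'.+1 => fun f e => (f 0 ^+ e.1 * boxmon (fun i => f i.+1) e.2)%R
  end.

Section ChainGrowth.
Local Open Scope ring_scope.
Variables (k : fieldType) (N : nat) (p : 'I_N -> k).
Local Notation R := {mpoly k[N]}.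
Local Notation mpow := (mpow p).

Definition add_mpow (P : R -> Prop) n (f : R) := exists2 g, P g & mpow n (f - g).

Section AddMpow.
Variable P : R -> Prop.
Hypothesis Pid : is_ideal P.

Lemma add_mpowD n f g : add_mpow P n f -> add_mpow P n g -> add_mpow P n (f + g).
Proof.
case: Pid => _ PD _ [f' Pf Ef] [g' Pg Eg]; exists (f' + g'); first exact: PD.
by rewrite opprD addrACA; apply: mpowD.
Qed.

Lemma add_mpowM n a f : add_mpow P n f -> add_mpow P n (a * f).
Proof.
case: Pid => _ _ PM [f' Pf Ef]; exists (a * f'); first exact: PM.
by rewrite -mulrBr; apply: mpowMl.
Qed.

Lemma add_mpowZ n a f : add_mpow P n f -> add_mpow P n (a *: f).
Proof. by rewrite -mul_mpolyC; apply: add_mpowM. Qed.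

Lemma add_mpowB n f g : add_mpow P n f -> add_mpow P n g -> add_mpow P n (f - g).
Proof. by move=> ? ?; apply: add_mpowD => //; rewrite -mulN1r; apply: add_mpowM. Qed.

Lemma add_mpowW n f : P f -> add_mpow P n f.
Proof. by exists f; rewrite // subrr; apply: mpow0. Qed.

Lemma add_mpow_pow n f : mpow n f -> add_mpow P n f.
Proof. by exists 0; rewrite ?subr0 //; case: Pid. Qed.

Lemma add_mpow0 n : add_mpow P n 0.
Proof. exact/add_mpow_pow/mpow0. Qed.

Lemma add_mpow_leq n n' f : (n <= n')%N -> add_mpow P n' f -> add_mpow P n f.
Proof. by move=> le_n [g Pg fg]; exists g => //; apply: mpow_leq fg. Qed.

Lemma add_mpow_sum n (I : Type) (r : seq I) (C : pred I) (F : I -> R) :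
  (forall i, C i -> add_mpow P n (F i)) -> add_mpow P n (\sum_(i <- r | C i) F i).
Proof.
by move=> FP; apply: (big_ind (add_mpow P n)) => //; [apply: add_mpow0|apply: add_mpowD].
Qed.

End AddMpow.

Lemma add_mpow_sub (P P' : R -> Prop) n f :
  (forall g, P g -> P' g) -> add_mpow P n f -> add_mpow P' n f.
Proof. by move=> PP' [g /PP' P'g fg]; exists g. Qed.

(* Reducing a relation modulo [P 1] kills its part without [f 0]; Artin-Rees then allows
   division by [f 0], at the cost of a bounded number of powers of the maximal ideal. *)
Lemma chain_indep d (P : nat -> R -> Prop) (f : nat -> R) :
  (forall j, (j <= d)%N -> is_prime_ideal (P j)) ->
  (forall j, (j < d)%N -> (forall g, P j g -> P j.+1 g) /\ P j.+1 (f j) /\ ~ P j (f j)) ->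
  (forall g, P d g -> g.@[p] = 0) ->
  exists2 C, (0 < C)%N &
    forall n, (0 < n)%N -> indep_mod (add_mpow (P 0%N) (C * n)) (@boxmon _ d n f).
Proof.
elim: d P f => [|d IH] P f Pprime Pstep Ptop.
  exists 1%N => // n n0 a; rewrite (big_pred1 tt) => [|[]] //.
  move=> [g /Ptop gp]; rewrite mul1n => /(mpow_leq n0)/mpow1P.
  by rewrite mevalB gp subr0 mevalZ meval1 mulr1 => a0 [].
have [||//|C C0 CP] := IH (fun j => P j.+1) (fun j => f j.+1).
- by move=> j jd; apply: Pprime.
- by move=> j jd; apply: Pstep.
have P0 := Pprime _ (leq0n _); have [P1 _ _] := Pprime 1%N isT.
have [P01 [P1f nP0f]] := Pstep 0%N isT.
have [c cP] := artin_rees p P0 nP0f.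
(* Dividing up to n times by [f 0] costs c * n powers of the maximal ideal; C * n remain for the
   induction hypothesis. *)
exists (C + c)%N => [|n n0]; first by rewrite addn_gt0 C0.
pose g (a : nat -> box d n -> k) i := \sum_(e : box d n) a i e *: boxmon (fun j => f j.+1) e : R.
suff key m : forall a : nat -> box d n -> k,
    add_mpow (P 0%N) (C * n + c * m) (\sum_(i < m) f 0%N ^+ i * g a i) ->
    forall i e, (i < m)%N -> a i e = 0.
  move=> a Pa [i e]; pose b j e' := if insub j is Some j' then a (j', e') else 0.
  have := key n b _ i e (ltn_ord i); rewrite /b valK; apply.
  rewrite -mulnDl; suff -> : \sum_(i < n) f 0%N ^+ i * g b i = \sum_t a t *: boxmon f t by [].
  transitivity (\sum_(i < n) \sum_(e : box d n) a (i, e) *: boxmon f ((i, e) : box d.+1 n)).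
    apply: eq_bigr => j _; rewrite /g mulr_sumr; apply: eq_bigr => e' _.
    by rewrite scalerAr /b valK.
  by rewrite pair_bigA; apply: eq_bigr => -[].
elim: m => [|m IHm] a //; rewrite big_ord_recl expr0 mul1r.
pose h := \sum_(i < m) f 0%N ^+ i * g (fun i => a i.+1) i.
have -> : \sum_(i < m) f 0%N ^+ lift ord0 i * g a (lift ord0 i) = f 0%N * h.
  by rewrite mulr_sumr; apply: eq_bigr => i _; rewrite mulrA -exprS.
move=> Pa.
have a0 : forall e, a 0%N e = 0.
  apply: (CP n n0); rewrite -[X in add_mpow _ _ X](addrK (f 0%N * h)).
  apply: (add_mpowB P1); last by apply: add_mpowW; rewrite mulrC; case: P1 => _ _; apply.
  by apply: (add_mpow_sub P01); apply: add_mpow_leq Pa; apply: leq_addr.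
have g0 : g a 0%N = 0 by rewrite /g big1 // => e _; rewrite a0 scale0r.
rewrite g0 add0r in Pa.
have Ph := IHm (fun i => a i.+1) (cP _ _ _).
case=> [|i] e; first by rewrite a0.
rewrite ltnS => im; apply: Ph => //.
by rewrite -addnA -mulnSr.
Qed.

End ChainGrowth.

(** * Growth of the local ring bounded by the tangent space *)

Section TangentBound.
Local Open Scope ring_scope.
Variables (k : fieldType) (N : nat) (p : 'I_N -> k).
Local Notation R := {mpoly k[N]}.
Local Notation mpow := (mpow p).
Local Notation xshift := (xshift p).
Local Notation add_mpow := (add_mpow p).

Lemma taylor1 f : mpow 2 (f - f.@[p]%:MP - \sum_i (f^`M(i)).@[p] *: xshift i).
Proof.
have [g _ E] := mpow1_sub p f.
have dg i : (f^`M(i)).@[p] = (g i).@[p].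
  have -> : f^`M(i) = (f - f.@[p]%:MP)^`M(i) by rewrite mderivB mderivC subr0.
  have Ui : (U_(i) - U_(i))%MM = 0%MM :> 'X_{1..N}.
    by apply/mnmP => j; rewrite mnmBE subnn mnm0E.
  rewrite E (raddf_sum (mderiv i)) (raddf_sum (meval p)) (bigD1 i) //= big1 => [|j ji].
    by rewrite mderivM mevalD !mevalM !mevalB mevalXU mevalC subrr mulr0 add0r
      mderivB mderivC mderivX mnm1E eqxx subr0 scale1r Ui mpolyX0 meval1 mulr1 addr0.
  rewrite mderivM mevalD !mevalM !mevalB mevalXU mevalC subrr mulr0 add0r.
  by rewrite mderivB mderivC mderivX mnm1E (negPf ji) scale0r subr0 meval0 mulr0.
rewrite E -sumrB; apply: mpow_sum => i _.
rewrite dg -mul_mpolyC -mulrBl; apply: mpow_mulx; exact: mpow1_sub.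
Qed.

Section Span.
Variables (F : seq R) (t : nat) (B : 'M[k]_(t, N)) (Q : R -> Prop).
Hypotheses (Qid : is_ideal Q) (QF : forall f, f \in F -> Q f).
Hypothesis (Fp : forall f, f \in F -> f.@[p] = 0).
Hypothesis (HB : (1%:M <= jacobian_at F p + B)%MS).

Definition linform l : R := \sum_j B l j *: xshift j.
Local Notation ev := (mmap (@mpolyC N k) linform).

Lemma mpow1_linform l : mpow 1 (linform l).
Proof. by apply: mpow_sum => j _; apply/mpowZ/mpow1_xshift. Qed.

(** By [HB], the j-th covector is a combination of differentials of the equations and of rows of
    [B]; by Taylor expansion the former are congruent to elements of [Q] modulo the square of the
    maximal ideal. *)
Lemma xshift_linform j : exists psi : {mpoly k[t]},
  mpow 1 (ev psi) /\ add_mpow Q 2 (xshift j - ev psi).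
Proof.
have /sub_addsmxP[[u w] /= E] := submx_trans (submx1 (delta_mx 0 j : 'rV_N)) HB.
have Ew : ev (\sum_l w 0 l *: 'X_l) = \sum_l w 0 l *: linform l.
  by rewrite rmorph_sum; apply: eq_bigr => l _; rewrite /= mmapZ mmapX mmap1U mul_mpolyC.
have Lw : mpow 1 (\sum_l w 0 l *: linform l).
  by apply: mpow_sum => l _; apply/mpowZ/mpow1_linform.
exists (\sum_l w 0 l *: 'X_l); rewrite Ew; split=> //.
have -> : \sum_l w 0 l *: linform l = \sum_i (w *m B) 0 i *: xshift i.
  under eq_bigr do rewrite scaler_sumr.
  rewrite exchange_big; apply: eq_bigr => i _ /=.
  by rewrite mxE scaler_suml; apply: eq_bigr => l _; rewrite scalerA.
have -> : xshift j - \sum_i (w *m B) 0 i *: xshift i =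
    \sum_i (u *m jacobian_at F p) 0 i *: xshift i.
  have <- : \sum_i (delta_mx 0 j : 'rV[k]_N) 0 i *: xshift i = xshift j.
    rewrite (bigD1 j) //= mxE !eqxx scale1r big1 ?addr0 // => i ij.
    by rewrite mxE eqxx (negPf ij) scale0r.
  rewrite E -sumrB; apply: eq_bigr => i _; by rewrite -scalerBl mxE addrK.
under eq_bigr do rewrite mxE scaler_suml.
rewrite exchange_big; apply: add_mpow_sum => // r _ /=.
under eq_bigr do rewrite -scalerA.
rewrite -scaler_sumr; apply: add_mpowZ => //.
pose f := nth 0 F r; have fF : f \in F by rewrite mem_nth.
exists f; first exact: QF.
have -> : \sum_i jacobian_at F p r i *: xshift i = \sum_i (f^`M(i)).@[p] *: xshift i.
  by apply: eq_bigr => i _; rewrite mxE.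
by rewrite -opprB; apply: mpowN; have := taylor1 f; rewrite Fp // mpolyC0 subr0.
Qed.

Lemma mpow_linform n f : mpow n f -> exists psi : {mpoly k[t]},
  mpow n (ev psi) /\ add_mpow Q n.+1 (f - ev psi).
Proof.
elim: n f => [|n IH] f.
  move=> _; exists (f.@[p])%:MP; split=> //; rewrite mmapC.
  exact/add_mpow_pow/mpow1_sub.
case=> g gn ->.
have [psi psiP] := choice _ (fun i => IH _ (gn i)).
have [h hP] := choice _ xshift_linform.
exists (\sum_i psi i * h i).
have -> : ev (\sum_i psi i * h i) = \sum_i ev (psi i) * ev (h i).
  by rewrite rmorph_sum; apply: eq_bigr => i _; rewrite rmorphM.
split.
  apply: mpow_sum => i _; rewrite -addn1; apply: mpowM; first by case: (psiP i).
  by case: (hP i).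
rewrite -sumrB; apply: add_mpow_sum => // i _.
have [psin psi1] := psiP i; have [h1 h2] := hP i.
have -> : g i * xshift i - ev (psi i) * ev (h i) =
    (g i - ev (psi i)) * xshift i + ev (psi i) * (xshift i - ev (h i)).
  by move: (xshift i) => x; rewrite mulrBl mulrBr addrA subrK.
case: Qid => _ _ QM; apply: add_mpowD => //.
  have [u Qu Eu] := psi1; exists (u * xshift i); first by rewrite mulrC; apply: QM.
  by rewrite -mulrBl; apply: mpow_mulx.
have [u Qu Eu] := h2; exists (ev (psi i) * u); first exact: QM.
by rewrite -mulrBr -addn2; apply: mpowM.
Qed.

(** The remainder is corrected one order at a time, as in Nakayama's lemma: modulo [Q] and any power
    of the maximal ideal, t linear forms generate everything. *)
Lemma span_linform n f : exists phi : {mpoly k[t]}, add_mpow Q n (f - ev phi).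
Proof.
elim: n => [|n [phi [g Qg /mpow_linform[psi [_ Epsi]]]]].
  by exists 0; exact: add_mpow_pow.
exists (phi + psi); have -> : f - ev (phi + psi) = g + (f - ev phi - g - ev psi).
  by rewrite [_ - g]addrC -addrA addNKr rmorphD opprD addrA.
by apply: add_mpowD => //; apply: add_mpowW.
Qed.

End Span.

Section Spanned.
Variables (Q : R -> Prop) (n : nat) (S : finType) (v : S -> R).
Hypothesis Qid : is_ideal Q.

Definition spanned f := exists b : S -> k, add_mpow Q n (f - \sum_s b s *: v s).

Lemma spannedD f g : spanned f -> spanned g -> spanned (f + g).
Proof.
move=> [b bP] [c cP]; exists (fun s => b s + c s).
under eq_bigr do rewrite scalerDl.
by rewrite big_split opprD addrACA; apply: add_mpowD.
Qed.

Lemma spannedZ a f : spanned f -> spanned (a *: f).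
Proof.
move=> [b bP]; exists (fun s => a * b s).
under eq_bigr do rewrite -scalerA.
by rewrite -scaler_sumr -scalerBr; apply: add_mpowZ.
Qed.

Lemma spannedW f : add_mpow Q n f -> spanned f.
Proof. by exists (fun=> 0); rewrite big1 ?subr0 // => s _; rewrite scale0r. Qed.

Lemma spanned_gen s : spanned (v s).
Proof.
exists (fun s' => (s' == s)%:R); rewrite (bigD1 s) //= eqxx scale1r big1.
  by rewrite addr0 subrr; apply: add_mpow0.
by move=> s' /negPf ->; rewrite scale0r.
Qed.

Lemma spanned_sum (I : Type) (r : seq I) (C : pred I) (G : I -> R) :
  (forall i, C i -> spanned (G i)) -> spanned (\sum_(i <- r | C i) G i).
Proof.
move=> GP; apply: (big_ind spanned) => //; last exact: spannedD.
exact/spannedW/add_mpow0.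
Qed.

Lemma spanned_add f g : add_mpow Q n (f - g) -> spanned g -> spanned f.
Proof. by move=> fg sg; rewrite -(subrK g f); apply: spannedD => //; apply: spannedW. Qed.

End Spanned.

Section Bounds.
Variables (F : seq R) (P : nat -> R -> Prop) (d : nat).
Hypothesis Pprime : forall j, (j <= d)%N -> is_prime_ideal (P j).
Hypothesis Pstep : forall j, (j < d)%N ->
  (forall f, P j f -> P j.+1 f) /\ exists f, P j.+1 f /\ ~ P j f.
Hypothesis PF : forall f, f \in F -> P 0%N f.
Hypothesis Ptop : forall f, P d f -> max_ideal p f.

Let P0sub f : P 0%N f -> f.@[p] = 0.
Proof.
move=> P0f; apply: Ptop; elim: {1 3}d (leqnn d) => [|j IH] jd //.
by apply: (Pstep jd).1; apply: IH; apply: ltnW.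
Qed.

(* The Hilbert function of the bottom of a chain of length [d] grows at least like [n ^ d]. *)
Lemma chain_span : exists2 C, (0 < C)%N & forall n (S : finType) (v : S -> R),
  (0 < n)%N -> (forall f, spanned (P 0%N) (C * n) v f) -> (n ^ d <= #|S|)%N.
Proof.
have [f fP] : exists f : nat -> R, forall j, (j < d)%N -> P j.+1 (f j) /\ ~ P j (f j).
  apply: (choice (fun j f => (j < d)%N -> P j.+1 f /\ ~ P j f)) => j.
  by have [/Pstep[_ [f fP]]|_] := boolP (j < d)%N; [exists f | exists 0].
have [|C C0 CP] := chain_indep Pprime _ Ptop (f := f).
  by move=> j jd; split; [apply: (Pstep jd).1 | apply: fP].
have [P0 _ _] := Pprime (leq0n d).
exists C => // n S v n0 sp; rewrite -card_box.
apply: (indep_span_card _ _ _ (CP n n0)) (fun e => sp _).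
- exact: add_mpowD.
- by move=> a x; apply: add_mpowZ.
- exact: add_mpow0.
Qed.

Let t := tangent_dim F p.

(** The rows of [B] span a complement, of dimension t, of the row space of the Jacobian. *)
Let tangent_coords : exists B : 'M[k]_(t, N), (1%:M <= jacobian_at F p + B)%MS.
Proof.
suff [B BP] : exists B : 'M_(\rank (jacobian_at F p)^C%MS, N), (1%:M <= jacobian_at F p + B)%MS.
  by rewrite /t /tangent_dim -mxrank_compl; exists B.
exists (row_base (jacobian_at F p)^C%MS).
by rewrite (adds_eqmx (eqmx_refl _) (eq_row_base _)) sub1mx addsmx_compl_full.
Qed.

Lemma card_bmnm_le (r n : nat) : (#|{: 'X_{1..r < n}}| <= n ^ r)%N.
Proof.
have mn (m : 'X_{1..r < n}) i : (m i < n)%N.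
  apply: leq_ltn_trans (bmdeg m); rewrite mdegE (bigD1 i) //=; exact: leq_addr.
pose e (m : 'X_{1..r < n}) := [ffun i => Ordinal (mn m i)].
have e_inj : injective e.
  move=> m m' /ffunP em; apply/val_inj/mnmP => i.
  by have := em i; rewrite !ffunE => -[].
by have := leq_card e e_inj; rewrite card_ffun !card_ord.
Qed.

(** Monomials of degree below C * n in the t tangent coordinates span modulo [P 0] and the power C *
    n, so n^d <= (C n)^t for every positive n. *)
Lemma chain_length_le : (d <= t)%N.
Proof.
have [P0 _ _] := Pprime (leq0n d).
have Fp f : f \in F -> f.@[p] = 0 by move=> /PF/P0sub.
have [B HB] := tangent_coords.
have [C C0 CP] := chain_span.
rewrite leqNgt; apply/negP => td.
(* Large enough for (C n)^t < n^(t+1). *)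
pose n := (C ^ t).+1.
have sp f : spanned (P 0%N) (C * n) (fun m : 'X_{1..t < C * n} => mmap1 (linform B) m) f.
  have [phi phiP] := span_linform P0 PF Fp HB (C * n) f.
  apply: (spanned_add P0 phiP); rewrite /mmap; apply: (spanned_sum P0) => m _.
  rewrite mul_mpolyC; apply: (spannedZ P0).
  have [mn|mn] := ltnP (mdeg m) (C * n); first exact: (spanned_gen _ _ P0 (BMultinom mn)).
  apply: spannedW; apply: (add_mpow_pow P0); apply: (mpow_leq mn); apply: mpow_mon.
  exact: mpow1_linform.
have := leq_trans (CP n _ _ isT sp) (card_bmnm_le _ _).
apply/negP; rewrite -ltnNge expnMn.
apply: (@leq_trans (n ^ t.+1)); last by rewrite leq_exp2l // ltnS expn_gt0 C0.
by rewrite expnS ltn_pmul2r ?expn_gt0.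
Qed.

(* A relation of bounded order among the [t] tangent coordinates lowers the growth of the
   Hilbert function to [n ^ t.-1]: its lowest monomial [nu], in a graded monomial order,
   makes the multiples of [nu] redundant. *)
Section LowOrderRelation.
Variables (n : nat) (B : 'M[k]_(t, N)) (phi : {mpoly k[t]}).
Hypothesis phi0 : phi != 0.
Hypothesis phiP : add_mpow (P 0%N) n (mmap (@mpolyC N k) (linform B) phi).
Let nu := mlast phi.
Let S : finType := {m : 'X_{1..t < n} | ~~ (nu <= m)%MM}.

Lemma spanned_nondiv m :
  spanned (P 0%N) n (fun s : S => mmap1 (linform B) (val (val s))) (mmap1 (linform B) m).
Proof.
have [P0 _ _] := Pprime (leq0n d).
set tau := mmap1 (linform B).
have big m' : (n <= mdeg m')%N -> spanned (P 0%N) n (fun s : S => tau (val (val s))) (tau m').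
  move=> nm; apply: spannedW; apply: (add_mpow_pow P0); apply: (mpow_leq nm); apply: mpow_mon.
  exact: mpow1_linform.
(* The recursion climbs to larger monomials and stops: finitely many have degree below n, and the
   others lie in the n-th power of the maximal ideal. *)
have [c] := ubnP #|[set x : 'X_{1..t < n} | (m < x)%O]|.
elim: c m => // c IH m; rewrite ltnS => le_c.
have [mn|mn] := ltnP (mdeg m) n; last exact: big.
have [le_m|nle_m] := boolP (nu <= m)%MM; last first.
  have Hm : ~~ (nu <= BMultinom mn)%MM by [].
  exact: (@spanned_gen (P 0%N) n S (fun s => tau (val (val s))) P0 (exist _ (BMultinom mn) Hm)).
pose u := (m - nu)%MM; have um : (u + nu)%MM = m by rewrite /u submK.
have phinu : phi@_nu != 0 by rewrite -mcoeff_msupp mlast_supp.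
have tauD a b : tau (a + b)%MM = tau a * tau b.
  by rewrite /tau -!(mmapX (linform B) (@mpolyC N k)) mpolyXD rmorphM.
have -> : tau m = (phi@_nu)^-1 *: (tau u * mmap (@mpolyC N k) (linform B) phi
    + - \sum_(m' <- msupp phi | m' != nu) phi@_m' *: tau (u + m')%MM).
  have -> : tau u * mmap (@mpolyC N k) (linform B) phi =
      \sum_(m' <- msupp phi) phi@_m' *: tau (u + m')%MM.
    rewrite /mmap mulr_sumr; apply: eq_bigr => m' _.
    by rewrite mul_mpolyC -scalerAr -tauD.
  rewrite (bigD1_seq nu) ?msupp_uniq ?mlast_supp //= addrK um.
  by rewrite scalerA mulVf // scale1r.
apply: (spannedZ P0); apply: (spannedD P0).
  by apply: spannedW; apply: (add_mpowM P0).
rewrite -scaleN1r; apply: (spannedZ P0).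
rewrite big_seq_cond; apply: (spanned_sum P0) => m' /andP[m's m'nu].
apply: (spannedZ P0).
have lt_m : (m < (u + m')%MM)%O.
  by rewrite -um ltmc_add2r lt_neqAle eq_sym m'nu mlast_lemc.
have [um'|um'] := ltnP (mdeg (u + m')) n; last exact: big.
apply: IH; apply: leq_trans le_c; apply: proper_card; apply/properP; split.
  by apply/subsetP => x; rewrite !inE; apply: lt_trans.
by exists (BMultinom um'); rewrite !inE //= ltxx.
Qed.

(** A monomial not divisible by [nu] has an exponent below that of [nu]: t choices for its place, at
    most [a] for its value, and n^(t-1) for the remaining exponents. *)
Lemma card_nondiv a : (mdeg nu < a)%N -> (#|{: S}| <= t * a * n ^ t.-1)%N.
Proof.
move=> nua.
have mn (m : 'X_{1..t < n}) i : (m i < n)%N.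
  apply: leq_ltn_trans (bmdeg m); rewrite mdegE (bigD1 i) //=; exact: leq_addr.
have pick_l (s : S) : {l : 'I_t | (val (val s) l < nu l)%N}.
  case: s => m /= nm.
  have : [exists l, (m l < nu l)%N].
    by move: nm; apply: contraR; rewrite negb_exists => /forallP nl; apply/mnm_lepP => i;
      rewrite leqNgt.
  by move=> /existsP/sigW.
have nul l : (nu l < a)%N.
  by apply: leq_ltn_trans nua; rewrite mdegE (bigD1 l) //= leq_addr.
pose e (s : S) : 'I_t * 'I_a * {ffun 'I_t.-1 -> 'I_n} :=
  let: exist l ls := pick_l s in
  (l, Ordinal (ltn_trans ls (nul l)), [ffun i => Ordinal (mn (val s) (lift l i))]).
have e_inj : injective e.
  move=> s s'; rewrite /e; case: (pick_l s) (pick_l s') => [l ls] [l' ls'] [El].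
  subst l' => Ej /ffunP Ef; do 2!apply/val_inj; apply/mnmP => i.
  by case: (unliftP l i) => [j ->|-> //]; have := Ef j; rewrite !ffunE => -[].
by have := leq_card e e_inj; rewrite !card_prod card_ffun !card_ord.
Qed.

End LowOrderRelation.

(** If f in [P 0] were outside [P'], its expansion in the tangent coordinates would be small modulo
    [P 0], yet by Artin-Rees for [P'] it would have a term of degree below a fixed [a]. Such a
    relation lowers the growth modulo [P 0] to the exponent t - 1, too slow for a chain of length
    t. *)
Lemma smooth_chain_bottom (P' : R -> Prop) : d = t ->
  is_prime_ideal P' -> (forall f, f \in F -> P' f) -> (forall f, P' f -> f.@[p] = 0) ->
  forall f, P 0%N f -> P' f.
Proof.
move=> dt P'prime P'F P'p f P0f; apply: NNPP => nP'f.
have [P'id _ _] := P'prime; have [P0 _ _] := Pprime (leq0n d).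
have [c cP] := artin_rees p P'prime nP'f.
(* If f lay in [P'] plus the power c + 1, Artin-Rees applied to f * 1 would put 1 in [P'] plus the
   maximal ideal. *)
pose a := c.+1.
have nf : ~ add_mpow P' a f.
  move=> fa; have [|g P'g /mpow1P] := cP 1%N 1; first by rewrite mulr1.
  by rewrite mevalB meval1 P'p // subr0 => /eqP; rewrite oner_eq0.
(* One polynomial [phi] must represent f modulo both ideals, so the expansion is taken modulo their
   intersection. *)
pose Q g := P 0%N g /\ P' g.
have Qid : is_ideal Q.
  case: P0 P'id => a1 a2 a3 [b1 b2 b3]; split; first by split.
    by move=> x y [? ?] [? ?]; split; [apply: a2|apply: b2].
  by move=> z x [? ?]; split; [apply: a3|apply: b3].
have QF g : g \in F -> Q g by move=> gF; split; [apply: PF|apply: P'F].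
have Fp g : g \in F -> g.@[p] = 0 by move=> /PF/P0sub.
have [B HB] := tangent_coords.
have [C C0 CP] := chain_span.
(* As n exceeds t * a * C^(t-1), the power n^t beats the bound t * a * (C n)^(t-1); the summand [a]
   also gives a <= C * n. *)
pose n := (t * a * C ^ t.-1 + a)%N.
have an : (a <= C * n)%N.
  by apply: leq_trans (leq_pmull _ C0); apply: leq_addl.
have [phi phiP] := span_linform Qid QF Fp HB (C * n) f.
have phiP0 : add_mpow (P 0%N) (C * n) (mmap (@mpolyC N k) (linform B) phi).
  rewrite -[X in add_mpow _ _ X](subKr f); apply: (add_mpowB P0); first exact: add_mpowW.
  by apply: (add_mpow_sub _ phiP) => g [].
have [nu_phi phi0] : (mdeg (mlast phi) < a)%N /\ phi != 0.
  apply: NNPP => Hphi; apply: nf.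
  have phia : mpow a (mmap (@mpolyC N k) (linform B) phi).
    rewrite /mmap big_seq; apply: mpow_sum => m mphi; apply: mpowMl.
    apply: (@mpow_leq _ _ _ _ (mdeg m)); last by apply: mpow_mon; exact: mpow1_linform.
    rewrite leqNgt; apply/negP => ma; apply: Hphi; split.
      by apply: leq_ltn_trans ma; apply: lemc_mdeg; apply: mlast_lemc.
    by apply: contraTneq mphi => ->; rewrite msupp0.
  rewrite -[f](subrK (mmap (@mpolyC N k) (linform B) phi)); apply: (add_mpowD P'id).
    by apply: (add_mpow_leq an); apply: (add_mpow_sub _ phiP) => g [].
  exact: add_mpow_pow.
have n0 : (0 < n)%N by rewrite /n addnS.
have sp g : spanned (P 0%N) (C * n)
    (fun s : {m : 'X_{1..t < C * n} | ~~ (mlast phi <= m)%MM} =>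
       mmap1 (linform B) (val (val s))) g.
  have [psi psiP] := span_linform P0 PF Fp HB (C * n) g.
  apply: (spanned_add P0 psiP); rewrite /mmap; apply: (spanned_sum P0) => m _.
  by rewrite mul_mpolyC; apply: (spannedZ P0); apply: spanned_nondiv.
have := leq_trans (CP n _ _ n0 sp) (card_nondiv _ nu_phi).
apply/negP; rewrite -ltnNge dt.
case Et: {1 3}t => [|t']; first by rewrite expn0.
rewrite Et /= expnMn mulnA expnS ltn_pmul2r ?expn_gt0 ?n0 //.
by rewrite /n Et /= -[X in (X < _)%N]addn0 ltn_add2l.
Qed.

End Bounds.
End TangentBound.

(** * Matrix points and companion coordinates *)

Lemma mpoly_ring_ind (A : comNzRingType) r (T : {mpoly A[r]} -> Prop) :
  (forall c, T c%:MP%R) -> (forall i, T 'X_i%R) ->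
  (forall f g, T f -> T g -> T (f + g)%R) -> (forall f g, T f -> T g -> T (f * g)%R) ->
  forall f, T f.
Proof.
move=> TC TX TD TM; elim/mpolyind => [|c m f _ _ Tf]; first exact: (TC 0%R).
apply: TD => //; rewrite -mul_mpolyC mpolyXE_id; apply: (TM) => //.
apply: (big_ind T) => //; first exact: (TC 1%R).
move=> i _; elim: (m i) => [|j IH]; first exact: (TC 1%R).
by rewrite exprS; apply: (TM).
Qed.

Section Points.
Local Open Scope ring_scope.
Variables (k : fieldType) (m : nat) (beta : {fset 'X_{1..m}}).
Local Notation n := (hb_n beta).
Local Notation R := {mpoly k[hb_N beta]}.
Local Notation e := (@hb_mon m beta).
Local Notation X := (@hb_mat k m beta).

Definition monmx (K : pzRingType) (M : 'I_m -> 'M[K]_n) (c : 'X_{1..m}) : 'M[K]_n :=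
  \prod_(i < m) M i ^+ c i.

Definition unitcol (K : pzRingType) : 'cV[K]_n := \col_a (e a == 0%MM)%:R.

Definition is_point (K : pzRingType) (M : 'I_m -> 'M[K]_n) :=
  (forall i j, M i *m M j = M j *m M i) /\
  (forall b, monmx M (e b) *m unitcol K = delta_mx b 0).

Lemma eq_monmx (K : pzRingType) (M M' : 'I_m -> 'M[K]_n) c : M =1 M' -> monmx M c = monmx M' c.
Proof. by move=> E; apply: eq_bigr => i _; rewrite E. Qed.

Lemma eq_is_point (K : pzRingType) (M M' : 'I_m -> 'M[K]_n) : M =1 M' -> is_point M -> is_point M'.
Proof.
move=> E [cM mM]; split=> [i j|b]; first by rewrite -!E.
by rewrite -(eq_monmx _ E).
Qed.

Lemma map_monmx (K L : pzRingType) (f : {rmorphism K -> L}) (M : 'I_m -> 'M[K]_n) c :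
  map_mx f (monmx M c) = monmx (fun i => map_mx f (M i)) c.
Proof. by rewrite rmorph_prod; apply: eq_bigr => i _; rewrite rmorphXn. Qed.

Lemma map_unitcol (K L : pzRingType) (f : {rmorphism K -> L}) :
  map_mx f (unitcol K) = unitcol L.
Proof. by apply/matrixP => a b; rewrite !mxE rmorph_nat. Qed.

(** The functor of points of the chart: with it, homomorphisms are handled as tuples of matrices. *)
Lemma hb_equationsP (K : pzRingType) (rho : {rmorphism R -> K}) :
  (forall f, f \in hb_equations k beta -> rho f = 0) <->
  is_point (fun i => map_mx rho (X i)).
Proof.
have E1 i j a b : rho ((X i *m X j - X j *m X i) a b) =
    (map_mx rho (X i) *m map_mx rho (X j) - map_mx rho (X j) *m map_mx rho (X i)) a b.
  by rewrite -!map_mxM -map_mxB [RHS]mxE.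
have E2 b a : rho ((hb_matmon k beta (e b) *m hb_e1 k beta - delta_mx b 0) a 0) =
    (monmx (fun i => map_mx rho (X i)) (e b) *m unitcol K - delta_mx b 0) a 0.
  by rewrite -map_monmx -(map_unitcol rho) -map_mxM -(map_delta_mx rho) -map_mxB [RHS]mxE.
split=> [H|[cM mM] f].
  split=> [i j|b].
    apply/eqP; rewrite -subr_eq0; apply/eqP/matrixP => a b; rewrite -E1 [RHS]mxE.
    apply: H; rewrite mem_cat; apply/orP; left.
    by apply/allpairsP; exists ((i, j), (a, b)); rewrite !mem_enum.
  apply/eqP; rewrite -subr_eq0; apply/eqP/matrixP => a z; rewrite ord1 -E2 [RHS]mxE.
  apply: H; rewrite mem_cat; apply/orP; right.
  by apply/allpairsP; exists (b, a); rewrite !mem_enum.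
rewrite mem_cat => /orP[] /allpairsP.
  by case=> -[[i j] [a b]] [_ _ ->] /=; rewrite E1 cM subrr mxE.
by case=> -[b a] [_ _ ->] /=; rewrite E2 mM subrr mxE.
Qed.

Definition monbasis (K : pzRingType) (N : 'I_m -> 'M[K]_n) (v : 'cV[K]_n) : 'M[K]_n :=
  \matrix_(a, b) (monmx N (e b) *m v) a 0.

Lemma monbasis_col (K : pzRingType) (N : 'I_m -> 'M[K]_n) (v : 'cV[K]_n) b :
  monbasis N v *m delta_mx b 0 = monmx N (e b) *m v.
Proof. by rewrite -colE; apply/matrixP => a c; rewrite !mxE ord1. Qed.

Lemma eq_monbasis (K : pzRingType) (N N' : 'I_m -> 'M[K]_n) v :
  N =1 N' -> monbasis N v = monbasis N' v.
Proof. by move=> E; apply/matrixP => a b; rewrite [LHS]mxE [RHS]mxE (eq_monmx _ E). Qed.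

Lemma map_monbasis (K L : pzRingType) (f : {rmorphism K -> L}) (N : 'I_m -> 'M[K]_n) v :
  map_mx f (monbasis N v) = monbasis (fun i => map_mx f (N i)) (map_mx f v).
Proof. by apply/matrixP => a b; rewrite mxE [X in f X]mxE [RHS]mxE -map_monmx -map_mxM [RHS]mxE. Qed.

Lemma unitcolE (K : pzRingType) z : e z = 0%MM -> unitcol K = delta_mx z 0.
Proof.
move=> ez; apply/matrixP => a c; rewrite !mxE ord1 andbT -ez.
by rewrite /hb_mon (inj_eq val_inj) (inj_eq enum_val_inj).
Qed.

Section Evaluation.
Variables (K : comNzRingType) (iota : {rmorphism k -> K}).

Definition pt_eval (M : 'I_m -> 'M[K]_n) : {rmorphism R -> K} :=
  mmap iota (fun v : 'I_(hb_N beta) => let: (i, a, b) := enum_val v in M i a b).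

Lemma pt_evalC M c : pt_eval M c%:MP = iota c.
Proof. exact: mmapC. Qed.

Lemma pt_evalX M i a b : pt_eval M (hb_var k i a b) = M i a b.
Proof. by rewrite /pt_eval /= mmapX mmap1U enum_rankK. Qed.

Lemma pt_eval_mat M i : map_mx (pt_eval M) (X i) = M i.
Proof. by apply/matrixP => a b; rewrite !mxE pt_evalX. Qed.

Lemma pt_evalP M : (forall f, f \in hb_equations k beta -> pt_eval M f = 0) <-> is_point M.
Proof.
split=> [/hb_equationsP|H]; first by apply: eq_is_point => i; apply: pt_eval_mat.
by apply/hb_equationsP; apply: eq_is_point H => i; rewrite pt_eval_mat.
Qed.

End Evaluation.

Section Conjugation.
Variable K : fieldType.

Lemma monmx_conj (P : 'M[K]_n) (M N : 'I_m -> 'M[K]_n) c :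
  P \in unitmx -> (forall i, M i = invmx P *m N i *m P) ->
  monmx M c = invmx P *m monmx N c *m P.
Proof.
move=> uP E; rewrite /monmx.
apply: (big_ind2 (fun A B : 'M[K]_n => A = invmx P *m B *m P)).
- by rewrite -idmxE mulmx1 mulVmx.
- by move=> A A' B B' -> ->; rewrite -!mulmxE !mulmxA mulmxK.
move=> i _; elim: (c i) => [|j IH]; first by rewrite !expr0 -idmxE mulmx1 mulVmx.
by rewrite !exprS IH E -!mulmxE !mulmxA mulmxK.
Qed.


(** The monomials of beta applied to [v] form a basis. Passing to it turns [v] into the class of 1
    and produces the normalization required of a point. *)
Lemma conj_is_point (z : 'I_n) (N : 'I_m -> 'M[K]_n) v (M : 'I_m -> 'M[K]_n) : e z = 0%MM ->
  (forall i j, N i *m N j = N j *m N i) -> monbasis N v \in unitmx ->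
  (forall i, M i = invmx (monbasis N v) *m N i *m monbasis N v) -> is_point M.
Proof.
move=> ez cN uQ E; split=> [i j|b].
  by rewrite !E !mulmxA !mulmxK // -(mulmxA _ (N i)) cN !mulmxA.
rewrite (monmx_conj _ uQ E) (unitcolE K ez) -(mulmxA _ (monbasis N v)) monbasis_col ez.
have -> : monmx N 0%MM = 1%:M by rewrite /monmx big1 // => i _; rewrite mnm0E.
by rewrite mul1mx -mulmxA -monbasis_col mulKmx.
Qed.

End Conjugation.
End Points.

(* Points whose algebra is generated by [x_i0]: in the basis of powers of [x_i0], that
   coordinate acts by a companion matrix, and the others by polynomials in it. *)
Section Parametrization.
Local Open Scope ring_scope.
Variables (m : nat) (beta : {fset 'X_{1..m}}) (i0 : 'I_m).
Local Notation n := (hb_n beta).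
Local Notation e := (@hb_mon m beta).
Variable z : 'I_n.
Hypothesis ez : e z = 0%MM.

Section Ring.
Variable K : pzRingType.
Implicit Types y : 'I_m -> 'I_n -> K.

Definition companion y : 'M[K]_n :=
  \matrix_(a, b) if (b.+1 < n)%N then (a == b.+1 :> nat)%:R else y i0 a.

Definition powcol j : 'cV[K]_n := \col_a (a == j :> nat)%:R.

Definition parN y i : 'M[K]_n :=
  if i == i0 then companion y else \sum_a y i a *: companion y ^+ a.

Definition parQ y : 'M[K]_n := monbasis (parN y) (powcol 0).

Lemma powcolE (a : 'I_n) : powcol a = delta_mx a 0.
Proof. by apply/matrixP => b c; rewrite !mxE ord1 andbT. Qed.

Lemma companion_powcolS y j : (j.+1 < n)%N -> companion y *m powcol j = powcol j.+1.
Proof.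
move=> jn; have -> : powcol j = delta_mx (Ordinal (ltnW jn)) 0 by rewrite -powcolE.
by rewrite -colE; apply/matrixP => a c; rewrite !mxE jn.
Qed.

Lemma companion_last y j : j.+1 = n -> companion y *m powcol j = \col_a y i0 a.
Proof.
move=> jn; have jn' : (j < n)%N by rewrite -jn.
have -> : powcol j = delta_mx (Ordinal jn') 0 by rewrite -powcolE.
by rewrite -colE; apply/matrixP => a c; rewrite !mxE jn ltnn.
Qed.

Lemma companion_pow y j : (j < n)%N -> companion y ^+ j *m powcol 0 = powcol j.
Proof.
elim: j => [|j IH] jn; first by rewrite expr0 mul1mx.
by rewrite exprS -mulmxE -mulmxA IH ?companion_powcolS // ltnW.
Qed.

End Ring.

Lemma eq_companion (K : pzRingType) (y y' : 'I_m -> 'I_n -> K) :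
  (forall i a, y i a = y' i a) -> companion y = companion y'.
Proof. by move=> E; apply/matrixP => a b; rewrite !mxE E. Qed.

Lemma eq_parN (K : pzRingType) (y y' : 'I_m -> 'I_n -> K) i :
  (forall i a, y i a = y' i a) -> parN y i = parN y' i.
Proof.
move=> E; rewrite /parN (eq_companion E); case: eqP => // _.
by apply: eq_bigr => a _; rewrite E.
Qed.

Lemma eq_parQ (K : pzRingType) (y y' : 'I_m -> 'I_n -> K) :
  (forall i a, y i a = y' i a) -> parQ y = parQ y'.
Proof. by move=> E; apply: eq_monbasis => i; apply: eq_parN. Qed.

(** For a point, the columns express 1, x_i0, ..., x_i0^(n-1) in the basis beta. *)
Definition krylov (K : pzRingType) (M : 'I_m -> 'M[K]_n) : 'M[K]_n :=
  \matrix_(a, j) (M i0 ^+ j *m unitcol beta K) a 0.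

Lemma krylov_col (K : pzRingType) (M : 'I_m -> 'M[K]_n) (j : 'I_n) :
  krylov M *m powcol K j = M i0 ^+ j *m unitcol beta K.
Proof. by rewrite powcolE -colE; apply/matrixP => a c; rewrite !mxE ord1. Qed.

Lemma map_krylov (K L : pzRingType) (f : {rmorphism K -> L}) (M : 'I_m -> 'M[K]_n) :
  map_mx f (krylov M) = krylov (fun i => map_mx f (M i)).
Proof.
apply/matrixP => a b; rewrite mxE [X in f X]mxE [RHS]mxE -(map_unitcol _ f) -rmorphXn.
by rewrite -map_mxM [RHS]mxE.
Qed.

Lemma map_companion (K L : pzRingType) (f : {rmorphism K -> L}) y :
  map_mx f (companion y) = companion (fun i a => f (y i a)).
Proof. by apply/matrixP => a b; rewrite !mxE; case: ifP => // _; rewrite rmorph_nat. Qed.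

Lemma map_powcol (K L : pzRingType) (f : {rmorphism K -> L}) j :
  map_mx f (powcol K j) = powcol L j.
Proof. by apply/matrixP => a b; rewrite !mxE rmorph_nat. Qed.

Lemma map_parN (K L : pzRingType) (f : {rmorphism K -> L}) y i :
  map_mx f (parN y i) = parN (fun i a => f (y i a)) i.
Proof.
rewrite /parN; case: eqP => _; first exact: map_companion.
rewrite raddf_sum; apply: eq_bigr => a _.
by rewrite /= map_mxZ rmorphXn /= map_companion.
Qed.

Lemma map_parQ (K L : pzRingType) (f : {rmorphism K -> L}) y :
  map_mx f (parQ y) = parQ (fun i a => f (y i a)).
Proof.
by rewrite /parQ map_monbasis map_powcol; apply: eq_monbasis => i; rewrite map_parN.
Qed.

Lemma parN_comm (K : comPzRingType) (y : 'I_m -> 'I_n -> K) i j :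
  parN y i *m parN y j = parN y j *m parN y i.
Proof.
have Cc l : GRing.comm (parN y l) (companion y).
  rewrite /parN; case: eqP => // _; apply: commr_sym; apply: commr_sum => a _.
  by rewrite /GRing.comm -!mulmxE -scalemxAr -scalemxAl; congr (_ *: _); apply: commrX.
rewrite mulmxE -/(GRing.comm _ _) {2}/parN; case: eqP => // _.
apply: commr_sum => a _.
by rewrite /GRing.comm -!mulmxE -scalemxAr -scalemxAl; congr (_ *: _); apply: commrX.
Qed.

Section Field.
Variable K : fieldType.
Implicit Types (y : 'I_m -> 'I_n -> K) (M : 'I_m -> 'M[K]_n).

Definition parM y i : 'M[K]_n := invmx (parQ y) *m parN y i *m parQ y.

Lemma parM_is_point y : parQ y \in unitmx -> is_point (parM y).
Proof. by move=> uQ; apply: (conj_is_point ez (parN_comm y) uQ). Qed.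

Let n0 : (0 < n)%N. Proof. exact: leq_ltn_trans (leq0n _) (ltn_ord z). Qed.

Let eq_mulcol (A B : 'M[K]_n) :
  (forall j, (j < n)%N -> A *m powcol K j = B *m powcol K j) -> A = B.
Proof.
move=> E; apply/matrixP => a b; have := E b (ltn_ord b).
by rewrite powcolE -!colE => /matrixP/(_ a 0); rewrite !mxE.
Qed.

Let parN0 y i : parN y i *m powcol K 0 =
  if i == i0 then companion y *m powcol K 0 else \col_a y i a.
Proof.
rewrite /parN; case: eqP => // _; rewrite mulmx_suml.
apply/matrixP => b c; rewrite summxE ord1 (bigD1 b) //= -scalemxAl companion_pow // powcolE.
rewrite !mxE !eqxx mulr1 big1 ?addr0 // => a ab.
by rewrite -scalemxAl companion_pow // powcolE !mxE eq_sym (negPf ab) mulr0.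
Qed.

(** Coefficients in the basis of powers of x_i0: those of x_i, or for i = i0 those of x_i0^n, which
    form the last column of the companion matrix. *)
Definition krycoord M i : 'cV[K]_n :=
  invmx (krylov M) *m (if i == i0 then M i0 ^+ n else M i) *m unitcol beta K.

(** In the basis of powers, x_i0 acts by a companion matrix; any other x_i commutes with it, so it
    is determined by its value on 1 and is a polynomial in it. The normalization of a point makes
    [parQ y] the inverse of the Krylov matrix. *)
Lemma par_surj M : is_point M -> krylov M \in unitmx ->
  let y i a := krycoord M i a 0 in parQ y \in unitmx /\ parM y =1 M.
Proof.
move=> [cM mM] uU y; set U := krylov M.
have Ucol j : (j < n)%N -> U *m powcol K j = M i0 ^+ j *m unitcol beta K.
  by move=> jn; apply: (krylov_col M (Ordinal jn)).
have ycol i : \col_a y i a = krycoord M i by apply/matrixP => a c; rewrite mxE ord1.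
have UC : M i0 *m U = U *m companion y.
  apply: eq_mulcol => j jn; rewrite -!mulmxA Ucol // mulmxA mulmxE -exprS.
  have [jn'|nj] := ltnP j.+1 n; first by rewrite companion_powcolS // Ucol.
  have {nj} jn' : j.+1 = n by apply/eqP; rewrite eqn_leq jn nj.
  by rewrite companion_last // ycol /krycoord eqxx jn' !mulmxA mulmxV // mul1mx.
have UCj j : M i0 ^+ j *m U = U *m companion y ^+ j.
  elim: j => [|j IH]; first by rewrite !expr0 mul1mx mulmx1.
  by rewrite !exprS -!mulmxE -mulmxA IH mulmxA UC mulmxA.
have UN i : M i *m U = U *m parN y i.
  have [->|ni] := eqVneq i i0; first by rewrite /parN eqxx.
  apply: eq_mulcol => j jn; rewrite -(companion_pow y jn) -!mulmxA.
  rewrite [in LHS](mulmxA U) -UCj [in RHS](mulmxA (parN _ _)).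
  have -> : parN y i *m companion y ^+ j = companion y ^+ j *m parN y i.
    have := parN_comm y i i0; rewrite {2 3}/parN eqxx mulmxE => Ci.
    exact: (commrX j Ci).
  rewrite -!mulmxA parN0 (negPf ni) ycol /krycoord (negPf ni).
  rewrite [in RHS]mulmxA -UCj -!mulmxA mulKVmx // Ucol // expr0 mul1mx.
  have : GRing.comm (M i) (M i0 ^+ j) by apply: commrX; apply: cM.
  by rewrite /GRing.comm -!mulmxE !mulmxA => ->.
have EN i : parN y i = invmx U *m M i *m U by rewrite -mulmxA UN mulKmx.
have EQ : parQ y = invmx U.
  apply/matrixP => a b; rewrite mxE (monmx_conj _ uU EN) -(mulmxA _ U) Ucol // expr0 mul1mx.
  by rewrite -mulmxA mM -colE mxE.
rewrite EQ unitmx_inv; split=> // i.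
by rewrite /parM EQ invmxK EN !mulmxA mulmxV // mul1mx -mulmxA mulmxV // mulmx1.
Qed.

Let parQe1 y : parQ y *m unitcol beta K = powcol K 0.
Proof.
rewrite (unitcolE _ ez) monbasis_col ez.
have -> : monmx (parN y) 0%MM = 1%:M by rewrite /monmx big1 // => i _; rewrite mnm0E.
by rewrite mul1mx.
Qed.

Let parMX y i j : parQ y \in unitmx ->
  parM y i ^+ j *m unitcol beta K = invmx (parQ y) *m (parN y i ^+ j *m powcol K 0).
Proof.
move=> uQ; have -> : parM y i ^+ j = invmx (parQ y) *m parN y i ^+ j *m parQ y.
  elim: j => [|j IH]; first by rewrite !expr0 mulmx1 mulVmx.
  by rewrite !exprS IH -!mulmxE /parM !mulmxA mulmxK.
by rewrite -!mulmxA parQe1.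
Qed.

Lemma krylov_parM y : parQ y \in unitmx -> krylov (parM y) = invmx (parQ y).
Proof.
move=> uQ; apply: eq_mulcol => j jn.
by rewrite (krylov_col (parM y) (Ordinal jn)) parMX //= {1}/parN eqxx companion_pow //.
Qed.

(** With [par_surj], this makes [krycoord] inverse to the parametrization, so the parameters are
    rational functions on the chart. *)
Lemma krycoord_parM y i a : parQ y \in unitmx -> krycoord (parM y) i a 0 = y i a.
Proof.
move=> uQ; rewrite /krycoord krylov_parM // invmxK.
have [->|ni] := eqVneq i i0.
  rewrite -mulmxA parMX // mulKVmx // {1}/parN eqxx.
  have -> : companion y ^+ n = companion y *m companion y ^+ n.-1.
    by rewrite mulmxE -exprS prednK.
  rewrite -mulmxA companion_pow ?prednK //.
  by rewrite companion_last ?prednK // mxE.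
have := parMX i 1 uQ; rewrite !expr1 -mulmxA => ->.
by rewrite mulKVmx // parN0 (negPf ni) mxE.
Qed.

End Field.
End Parametrization.

(** * Transfer of primes between the parameter space and the chart *)

Section RationalCoordinates.
Local Open Scope ring_scope.
Variables (k : fieldType) (m : nat) (beta : {fset 'X_{1..m}}) (i0 : 'I_m).
Local Notation n := (hb_n beta).
Local Notation e := (@hb_mon m beta).
Local Notation R := {mpoly k[hb_N beta]}.
Local Notation X := (@hb_mat k m beta).
Variable z : 'I_n.
Hypothesis ez : e z = 0%MM.

Definition par_dim := #|{: 'I_m * 'I_n}|.
Local Notation Y := {mpoly k[par_dim]}.

Definition parX (i : 'I_m) (a : 'I_n) : Y := 'X_(enum_rank (i, a)).

Section Hom.
Variables (K : fieldType) (xi : {rmorphism Y -> K}).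

Definition par_hom : {rmorphism R -> K} :=
  pt_eval (xi \o @mpolyC par_dim k) (parM i0 (fun i a => xi (parX i a))).

Lemma par_homC c : par_hom c%:MP = xi c%:MP.
Proof. exact: pt_evalC. Qed.

Definition par_regular := xi (\det (parQ i0 parX)) != 0.

Lemma par_regularP : par_regular = (parQ i0 (fun i a => xi (parX i a)) \in unitmx).
Proof. by rewrite /par_regular -det_map_mx map_parQ unitmxE unitfE. Qed.

Lemma par_hom_equations f : par_regular -> f \in hb_equations k beta -> par_hom f = 0.
Proof.
rewrite par_regularP => uQ; apply: (proj2 (pt_evalP _ _)); apply: (parM_is_point ez uQ).
Qed.

Lemma par_hom_krylov : par_regular -> par_hom (\det (krylov i0 X)) != 0.
Proof.
rewrite par_regularP => uQ; rewrite -det_map_mx map_krylov.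
have -> : krylov i0 (fun i => map_mx par_hom (X i)) = krylov i0 (parM i0 (fun i a => xi (parX i a))).
  by apply/matrixP => a b; rewrite !mxE /par_hom pt_eval_mat.
by rewrite (krylov_parM ez uQ) -unitfE -unitmxE unitmx_inv.
Qed.

End Hom.

(** The adjugate clears the denominator det [parQ]. [A] and [G] do not depend on [xi], which permits
    comparing two specializations. *)
Lemma par_hom_numerator (f : R) : exists A (G : Y), forall (K : fieldType) (xi : {rmorphism Y -> K}),
  par_regular xi -> xi (\det (parQ i0 parX)) ^+ A * par_hom xi f = xi G.
Proof.
elim/mpoly_ring_ind: f => [c|v|f g [A [G GP]] [B [H HP]]|f g [A [G GP]] [B [H HP]]].
- by exists 0%N, c%:MP => K xi _; rewrite mul1r par_homC.
- have [[[i a] b] ->] : exists x : hb_V beta, v = enum_rank x.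
    by exists (enum_val v); rewrite enum_valK.
  exists 1%N, ((\adj (parQ i0 parX) *m parN i0 parX i *m parQ i0 parX) a b) => K xi reg.
  rewrite expr1 [par_hom xi _]pt_evalX.
  have := reg; rewrite par_regularP /parM => uQ.
  rewrite /invmx uQ -!scalemxAl mxE -map_parQ -map_parN det_map_mx mulrA mulfV // mul1r.
  by rewrite -map_mx_adj -!map_mxM mxE.
- exists (A + B)%N, (\det (parQ i0 parX) ^+ B * G + \det (parQ i0 parX) ^+ A * H) => K xi reg.
  rewrite rmorphD mulrDr exprD rmorphD !rmorphM !rmorphXn -GP // -HP //.
  by rewrite [X in X * par_hom xi f]mulrC !mulrA.
- exists (A + B)%N, (G * H) => K xi reg.
  by rewrite !rmorphM exprD -GP // -HP // mulrACA.
Qed.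

(** The converse passage: by Cramer's rule each parameter is a quotient with the Krylov determinant
    as denominator. *)
Lemma par_hom_lift (G : Y) : exists A (f : R), forall (K : fieldType) (xi : {rmorphism Y -> K}),
  par_regular xi -> par_hom xi f = par_hom xi (\det (krylov i0 X)) ^+ A * xi G.
Proof.
elim/mpoly_ring_ind: G => [c|v|f g [A [G GP]] [B [H HP]]|f g [A [G GP]] [B [H HP]]].
- by exists 0%N, c%:MP => K xi _; rewrite mul1r par_homC.
- have [[i a] ->] : exists x : 'I_m * 'I_n, v = enum_rank x.
    by exists (enum_val v); rewrite enum_valK.
  exists 1%N, ((\adj (krylov i0 X) *m (if i == i0 then X i0 ^+ n else X i) *m unitcol beta R) a 0) => K xi reg.
  have Hk := par_hom_krylov reg.
  have := reg; rewrite par_regularP => uQ.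
  rewrite expr1 -/(parX i a) -(krycoord_parM (i0 := i0) ez i a uQ) /krycoord.
  set M := parM _ _.
  have EX j : map_mx (par_hom xi) (X j) = M j by apply: pt_eval_mat.
  have EK : krylov i0 M = map_mx (par_hom xi) (krylov i0 X).
    by rewrite map_krylov; apply/matrixP => b c; rewrite !mxE EX.
  have uK : krylov i0 M \in unitmx by rewrite unitmxE EK det_map_mx unitfE.
  rewrite /invmx uK -!scalemxAl [in RHS]mxE EK det_map_mx mulrA mulfV // mul1r.
  have -> : (if i == i0 then M i0 ^+ n else M i) =
      map_mx (par_hom xi) (if i == i0 then X i0 ^+ n else X i).
    by case: eqP => _; rewrite ?rmorphXn /= EX.
  by rewrite -map_mx_adj -(map_unitcol _ (par_hom xi)) -!map_mxM [RHS]mxE.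
- exists (A + B)%N, (\det (krylov i0 X) ^+ B * G + \det (krylov i0 X) ^+ A * H) => K xi reg.
  rewrite !rmorphD !rmorphM !rmorphXn GP // HP // mulrDr exprD.
  by rewrite [X in _ = X * xi f + _]mulrC !mulrA.
- exists (A + B)%N, (G * H) => K xi reg.
  by rewrite !rmorphM exprD GP // HP // mulrACA.
Qed.

(** Numerators decide vanishing, since the denominator is nonzero at both points; inclusions of
    primes thus pass from the parameters to the chart. *)
Lemma par_hom_ker (K L : fieldType) (xi : {rmorphism Y -> K}) (eta : {rmorphism Y -> L}) :
  par_regular xi -> par_regular eta -> (forall G, xi G = 0 -> eta G = 0) ->
  forall f, par_hom xi f = 0 -> par_hom eta f = 0.
Proof.
move=> regx rege ker f f0; have [A [G GP]] := par_hom_numerator f.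
have := GP _ _ regx; rewrite f0 mulr0 => /esym/ker/eqP.
by rewrite -GP // mulf_eq0 expf_eq0 (negPf rege) andbF => /eqP.
Qed.

Lemma par_hom_ker_strict (K L : fieldType) (xi : {rmorphism Y -> K}) (eta : {rmorphism Y -> L}) G :
  par_regular xi -> par_regular eta -> xi G = 0 -> eta G != 0 ->
  exists f, par_hom xi f = 0 /\ par_hom eta f != 0.
Proof.
move=> regx rege x0 e0; have [A [f fP]] := par_hom_lift G.
exists f; rewrite !fP // x0 mulr0; split=> //.
by rewrite mulf_neq0 // expf_neq0 // par_hom_krylov.
Qed.

End RationalCoordinates.

(** * A curve through the monomial point *)

Section ResidueField.
Local Open Scope ring_scope.
Local Open Scope quotient_scope.
Variables (k : fieldType) (N : nat).
Local Notation R := {mpoly k[N]}.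

(** [L] is the fraction field of the quotient by [P]. Classical choice supplies the Boolean
    membership in [P] and the inverse operation that the quotient must carry as an integral
    domain. *)
Lemma residue_field (P : R -> Prop) : is_prime_ideal P ->
  exists (L : fieldType) (rho : {rmorphism R -> L}), forall f, rho f = 0 <-> P f.
Proof.
move=> [[P0 PD PM] P1 PP].
pose I : {pred R} := fun f => if excluded_middle_informative (P f) then true else false.
have IP f : reflect (P f) (f \in I).
  by rewrite unfold_in /I; case: excluded_middle_informative => ?; constructor.
have Izmod : zmod_closed I.
  split; first exact/IP.
  by move=> f g /IP Pf /IP Pg; apply/IP; apply: PD => //; rewrite -mulN1r; apply: PM.
have Iproper : 1 \notin I /\ forall a, {in I, forall f, a * f \in I}.
  by split; [apply/IP | move=> a f /IP Pf; apply/IP; apply: PM].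
have Iprime : prime_idealr_closed I.
  by move=> f g /IP/PP[] ?; apply/orP; [left|right]; apply/IP.
pose I1 := GRing.isZmodClosed.Build _ I Izmod.
pose I2 := isProperIdeal.Build _ I Iproper.
pose I3 := isPrimeIdealrClosed.Build _ I Iprime.
pose J : prime_idealr _ := HB.pack I I1 I2 I3.
pose E : comNzRingType := {ideal_quot J}.
pose pi : {rmorphism R -> E} := \pi_E.
have piP f : pi f = 0 <-> P f.
  split=> [/eqP|Pf]; first by rewrite piE Quotient.equivE subr0 => /IP.
  by apply/eqP; rewrite piE Quotient.equivE subr0; apply/IP.
pose u : pred E := fun x => if excluded_middle_informative (exists y, y * x = 1) then true else false.
pose v x : E := match excluded_middle_informative (exists y, y * x = 1) with
  | left ex => sval (constructive_indefinite_description _ ex) | right _ => x end.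
have vu : {in u, left_inverse 1 v *%R}.
  move=> x; rewrite unfold_in /u /v; case: excluded_middle_informative => // ex _.
  by case: constructive_indefinite_description.
have uv x y : y * x = 1 -> u x.
  by move=> yx; rewrite /u; case: excluded_middle_informative => // -[]; exists y.
have v_out : {in [predC u], v =1 id}.
  by move=> x; rewrite inE unfold_in /u /v; case: excluded_middle_informative.
pose E1 := GRing.ComNzRing_hasMulInverse.Build E vu uv v_out.
pose EU : comUnitRingType := HB.pack E E1.
pose E2 := GRing.ComUnitRing_isIntegral.Build EU (@Quotient.rquot_IdomainAxiom _ J).
pose D : idomainType := HB.pack EU E2.
exists {fraction D}, (@tofrac D \o (pi : R -> D)) => f /=.
by rewrite -piP; split=> [/eqP|->]; [rewrite tofrac_eq0 => /eqP | rewrite tofrac0].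
Qed.

End ResidueField.

(** * Specialization from k(s) to s = 0 *)

Section ValueAtZero.
Local Open Scope ring_scope.
Variable k : fieldType.
Local Notation K := {fraction {poly k}}.
Local Notation "x %:F" := (@tofrac {poly k} x).

(* [x] is regular at [0] with value [c] there. *)
Definition val0 (x : K) (c : k) :=
  exists u d : {poly k}, [/\ d.[0] != 0, x * d%:F = u%:F & c * d.[0] = u.[0]].

Lemma val0_poly u : val0 u%:F u.[0].
Proof. by exists u, 1; rewrite hornerC oner_neq0 tofrac1 !mulr1. Qed.

Lemma val0C c : val0 (c%:P)%:F c.
Proof. by have := val0_poly c%:P; rewrite hornerC. Qed.

Lemma val0_0 : val0 0 0.
Proof. by have := val0C 0; rewrite polyC0 tofrac0. Qed.

Lemma val0_1 : val0 1 1.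
Proof. by have := val0C 1; rewrite polyC1 tofrac1. Qed.

Lemma val0D x y a b : val0 x a -> val0 y b -> val0 (x + y) (a + b).
Proof.
move=> [u [d [d0 xu au]]] [v [c [c0 yv bv]]]; exists (u * c + v * d), (d * c).
split; first by rewrite hornerM mulf_neq0.
  rewrite tofracD !tofracM -xu -yv mulrDl mulrA; congr (_ + _).
  by rewrite mulrCA mulrC mulrAC.
rewrite hornerD !hornerM -au -bv mulrDl mulrA; congr (_ + _).
by rewrite mulrCA mulrC mulrAC.
Qed.

Lemma val0M x y a b : val0 x a -> val0 y b -> val0 (x * y) (a * b).
Proof.
move=> [u [d [d0 xu au]]] [v [c [c0 yv bv]]]; exists (u * v), (d * c).
split; first by rewrite hornerM mulf_neq0.
  by rewrite !tofracM -xu -yv mulrACA.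
by rewrite !hornerM -au -bv mulrACA.
Qed.

Lemma val0_zero c : val0 0 c -> c = 0.
Proof.
move=> [u [d [d0 /esym/eqP]]]; rewrite mul0r tofrac_eq0 => /eqP -> /eqP.
by rewrite horner0 mulf_eq0 (negPf d0) orbF => /eqP.
Qed.

Lemma val0V x a : val0 x a -> a != 0 -> val0 x^-1 a^-1.
Proof.
move=> [u [d [d0 xu au]]] a0; have u0 : u.[0] != 0 by rewrite -au mulf_neq0.
have x0 : x != 0.
  apply: contraNneq u0 => x0; move/esym/eqP: xu; rewrite x0 mul0r tofrac_eq0 => /eqP ->.
  by rewrite horner0.
by exists d, u; rewrite u0 -xu -au !mulrA !mulVf // !mul1r.
Qed.

Lemma val0_sum (I : Type) (r : seq I) (Q : pred I) (F : I -> K) (G : I -> k) :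
  (forall i, Q i -> val0 (F i) (G i)) -> val0 (\sum_(i <- r | Q i) F i) (\sum_(i <- r | Q i) G i).
Proof.
move=> H; apply: (big_ind2 val0) => //; first exact: val0_0.
by move=> *; apply: val0D.
Qed.

Lemma val0_prod (I : Type) (r : seq I) (Q : pred I) (F : I -> K) (G : I -> k) :
  (forall i, Q i -> val0 (F i) (G i)) -> val0 (\prod_(i <- r | Q i) F i) (\prod_(i <- r | Q i) G i).
Proof.
move=> H; apply: (big_ind2 val0) => //; first exact: val0_1.
by move=> *; apply: val0M.
Qed.

Definition val0_mx r t (A : 'M[K]_(r, t)) (B : 'M[k]_(r, t)) := forall i j, val0 (A i j) (B i j).

Lemma val0_mxM r t q (A : 'M[K]_(r, t)) A' (B : 'M[K]_(t, q)) B' :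
  val0_mx A A' -> val0_mx B B' -> val0_mx (A *m B) (A' *m B').
Proof. by move=> HA HB i j; rewrite !mxE; apply: val0_sum => l _; apply: val0M. Qed.

Lemma val0_mx1 r : val0_mx (1%:M : 'M[K]_r) 1%:M.
Proof. by move=> i j; rewrite !mxE; case: eqP => _; [apply: val0_1|apply: val0_0]. Qed.

Lemma val0_mxX r (A : 'M[K]_r) B j : val0_mx A B -> val0_mx (A ^+ j) (B ^+ j).
Proof.
move=> HA; elim: j => [|j IH]; first exact: val0_mx1.
by rewrite !exprS; apply: val0_mxM.
Qed.

Lemma val0_sign j : val0 ((-1) ^+ j) ((-1) ^+ j).
Proof.
have N1 : val0 (-1) (-1) by have := val0C (-1); rewrite polyCN tofracN polyC1 tofrac1.
by elim: j => [|j IH]; [exact: val0_1 | rewrite !exprS; apply: val0M].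
Qed.

Lemma val0_det r (A : 'M[K]_r) B : val0_mx A B -> val0 (\det A) (\det B).
Proof.
move=> HA; apply: val0_sum => s _; apply: val0M; first exact: val0_sign.
by apply: val0_prod => i _; apply: HA.
Qed.

Lemma val0_invmx r (A : 'M[K]_r) B : val0_mx A B -> B \in unitmx -> val0_mx (invmx A) (invmx B).
Proof.
move=> HA uB; have dA := val0_det HA.
have dB : \det B != 0 by rewrite -unitfE -unitmxE.
have uA : A \in unitmx.
  rewrite unitmxE unitfE; apply: contraNneq dB => dA0.
  by apply/eqP/val0_zero; rewrite -dA0.
move=> i j; rewrite /invmx uA uB !mxE; apply: val0M; first exact: val0V.
apply: val0M; first exact: val0_sign.
by apply: val0_det => a b; rewrite !mxE; apply: HA.
Qed.

End ValueAtZero.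

(** * Distracted monomials and their points *)

Section Distraction.
Local Open Scope ring_scope.
Variables (m : nat) (beta : {fset 'X_{1..m}}).
Local Notation n := (hb_n beta).
Local Notation e := (@hb_mon m beta).
Hypothesis beta_closed : forall a b : 'X_{1..m}, a \in beta -> (b <= a)%MM -> b \in beta.

Lemma hb_mon_inj : injective e.
Proof. by move=> a b /val_inj/enum_val_inj. Qed.

Lemma hb_mon_in a : e a \in beta.
Proof. exact: valP. Qed.

Lemma hb_monP c : c \in beta -> exists a, e a = c.
Proof. by move=> cb; exists (enum_rank [` cb]%fset); rewrite /hb_mon enum_rankK. Qed.

(** Multiplication by x_i modulo I_beta in the basis beta; over k these matrices are the coordinates
    of [hb_point]. *)
Definition shiftmx (K : pzRingType) i : 'M[K]_n := \matrix_(a, b) ((e b + U_(i))%MM == e a)%:R.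

Lemma shiftmx_delta (K : pzRingType) i b c :
  e c = (e b + U_(i))%MM -> shiftmx K i *m delta_mx b 0 = delta_mx c (0 : 'I_1).
Proof.
move=> ec; rewrite -colE; apply/matrixP => a j; rewrite !mxE ord1 andbT -ec.
by rewrite (inj_eq hb_mon_inj) eq_sym.
Qed.

Lemma shiftmxM (K : pzRingType) i j a b :
  (shiftmx K i *m shiftmx K j) a b = ((e b + U_(j) + U_(i))%MM == e a)%:R.
Proof.
rewrite mxE; have [bj|bj] := boolP ((e b + U_(j))%MM \in beta).
  have [c ec] := hb_monP bj.
  rewrite (bigD1 c) //= !mxE ec eqxx mulr1 big1 ?addr0 // => c' c'c.
  by rewrite !mxE -ec (inj_eq hb_mon_inj) [c == _]eq_sym (negPf c'c) mulr0.
rewrite big1 => [|c _].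
  case: eqP => // Ea; case/negP: bj; apply: beta_closed (hb_mon_in a) _.
  by rewrite -Ea lem_addr.
rewrite !mxE; case: (_ =P e c) => [E|_]; last by rewrite mulr0.
by case/negP: bj; rewrite E hb_mon_in.
Qed.

Lemma monbasis_shiftmx (K : pzRingType) z : e z = 0%MM ->
  monbasis (shiftmx K) (delta_mx z 0) = 1%:M.
Proof.
move=> ez.
have powS i j : forall b c, e c = (e b + U_(i) *+ j)%MM ->
    shiftmx K i ^+ j *m delta_mx b 0 = delta_mx c (0 : 'I_1).
  elim: j => [|j IH] b c ec.
    by rewrite expr0 mul1mx; congr delta_mx; apply: hb_mon_inj; rewrite ec mulm0n addm0.
  have [d ed] : exists d, e d = (e b + U_(i) *+ j)%MM.
    apply: hb_monP; apply: beta_closed (hb_mon_in c) _.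
    by rewrite ec mulmSr addmA lem_addr.
  rewrite exprS -mulmxE -mulmxA (IH _ _ ed); apply: shiftmx_delta.
  by rewrite ec ed mulmSr addmA.
have prodS (c : 'X_{1..m}) (r : seq 'I_m) : forall b, e b = (\sum_(i <- r) U_(i) *+ c i)%MM ->
    (\prod_(i <- r) shiftmx K i ^+ c i) *m delta_mx z 0 = delta_mx b (0 : 'I_1).
  elim: r => [|i r IH] b; rewrite !(big_nil, big_cons) => eb.
    by rewrite mul1mx; congr delta_mx; apply: hb_mon_inj; rewrite ez.
  have [d ed] : exists d, e d = (\sum_(i <- r) U_(i) *+ c i)%MM.
    by apply: hb_monP; apply: beta_closed (hb_mon_in b) _; rewrite eb lem_addl.
  by rewrite -mulmxE -mulmxA (IH _ ed); apply: powS; rewrite eb ed addmC.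
apply/matrixP => a b; rewrite mxE (prodS _ _ b) -?multinomUE_id // !mxE eqxx andbT.
by [].
Qed.

Section Field.
Variables (K : fieldType) (alpha : 'I_m -> nat -> K).

(* The matrix of [x_i] in the basis of distracted monomials
   [prod_i prod_(j < c_i) (x_i - alpha i j)], [c] in [beta]. *)
Definition distmx i : 'M[K]_n := \matrix_(a, b) (alpha i (e b i) *+ (a == b)) + shiftmx K i.

(** The diagonal part of x_i depends on the i-th exponent alone, which multiplication by another
    variable preserves. *)
Lemma distmx_comm i j : distmx i *m distmx j = distmx j *m distmx i.
Proof.
have [->//|ij] := eqVneq i j.
pose D i : 'M[K]_n := diag_mx (\row_b alpha i (e b i)).
have E l : distmx l = D l + shiftmx K l.
  congr (_ + _); apply/matrixP => a b; rewrite !mxE; case: eqP => [->|] //.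
have DS u v : u != v -> D u *m shiftmx K v = shiftmx K v *m D u.
  move=> uv; apply/matrixP => a b; rewrite mul_diag_mx mul_mx_diag !mxE mulrC.
  case: eqP => [<-|_]; last by rewrite !mul0r.
  by rewrite mnmDE mnm1E eq_sym (negPf uv) addn0.
have SS : shiftmx K i *m shiftmx K j = shiftmx K j *m shiftmx K i.
  by apply/matrixP => a b; rewrite !shiftmxM -!addmA [(U_(j) + _)%MM]addmC.
rewrite !E !mulmxDl !mulmxDr SS !(DS i j) // -(DS j i) 1?eq_sym // diag_mxC.
by rewrite addrACA.
Qed.

(* Rows are evaluations of the distracted monomials at the points [(alpha i (b i))_i],
   hence joint left eigenvectors. *)
Definition evmx : 'M[K]_n :=
  \matrix_(b, c) \prod_i \prod_(j < e c i) (alpha i (e b i) - alpha i j).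

Lemma evmx_distmx i : evmx *m distmx i = diag_mx (\row_b alpha i (e b i)) *m evmx.
Proof.
pose w b (x : 'X_{1..m}) := \prod_i \prod_(j < x i) (alpha i (e b i) - alpha i j).
have wS b x : w b (x + U_(i))%MM = w b x * (alpha i (e b i) - alpha i (x i)).
  rewrite /w (bigD1 i) //= [in RHS](bigD1 i) //= mnmDE mnm1E eqxx addn1 big_ord_recr /=.
  rewrite mulrAC; congr (_ * _ * _); apply: eq_bigr => i' i'i.
  by rewrite mnmDE mnm1E eq_sym (negPf i'i) addn0.
apply/matrixP => b c; rewrite mul_diag_mx [in RHS]mxE.
rewrite /distmx mulmxDr [in LHS]mxE.
have -> : (evmx *m \matrix_(a, b) (alpha i (e b i) *+ (a == b))) b c = w b (e c) * alpha i (e c i).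
  rewrite mxE (bigD1 c) //= !mxE eqxx mulr1n [X in _ + X]big1 ?addr0 // => d dc.
  by rewrite !mxE (negPf dc) mulr0.
have -> : (evmx *m shiftmx K i) b c = w b (e c + U_(i))%MM.
  rewrite mxE; have [ci|ci] := boolP ((e c + U_(i))%MM \in beta).
    have [d ed] := hb_monP ci.
    rewrite (bigD1 d) //= !mxE ed eqxx mulr1 [X in _ + X]big1 ?addr0 // => d' d'd.
    by rewrite !mxE -ed (inj_eq hb_mon_inj) [d == _]eq_sym (negPf d'd) mulr0.
  rewrite big1 => [|d _]; last first.
    rewrite !mxE; case: (_ =P e d) => [E|_]; last by rewrite mulr0.
    by case/negP: ci; rewrite E hb_mon_in.
  (* Outside beta some exponent exceeds that of b, and the distracted monomial then has a factor
     vanishing at the point of b. *)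
  have : ~~ (e c + U_(i) <= e b)%MM by apply: contra ci => /(beta_closed (hb_mon_in b)).
  rewrite /lem negb_forall => /existsP[i']; rewrite -ltnNge => bi'.
  by rewrite /w (bigD1 i') //= (bigD1 (Ordinal bi')) //= subrr !mul0r.
by rewrite wS mulrBr addrC subrK mulrC !mxE.
Qed.

End Field.
End Distraction.

Lemma det_conjmx (F : fieldType) r (A P : 'M[F]_r) :
  P \in unitmx -> (\det (invmx P *m A *m P) = \det A)%R.
Proof.
by rewrite unitmxE unitfE !det_mulmx det_inv mulrAC => dP; rewrite mulVf // mul1r.
Qed.

Lemma det_eigen (F : fieldType) r (A P : 'M[F]_r) d :
  P \in unitmx -> (P *m A = diag_mx d *m P -> \det A = \prod_b d 0 b)%R.
Proof.
rewrite unitmxE unitfE => dP /(congr1 determinant); rewrite !det_mulmx det_diag mulrC.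
exact: mulIf.
Qed.

Section Curve.
Local Open Scope ring_scope.
Variables (k : fieldType) (m : nat) (beta : {fset 'X_{1..m}}) (i0 : 'I_m).
Local Notation n := (hb_n beta).
Local Notation e := (@hb_mon m beta).
Hypothesis beta_closed : forall a b : 'X_{1..m}, a \in beta -> (b <= a)%MM -> b \in beta.
Variable z : 'I_n.
Hypothesis ez : e z = 0%MM.
Local Notation K := {fraction {poly k}}.

Let s : K := @tofrac {poly k} 'X.
(** Distinct exponents for all pairs (i, j). Starting at 2 keeps the exponent of [alpha] positive
    after its decrement. For i other than i0 the decrement is made up by the factor s of the shear,
    so the eigenvalue [lam b] of x_i0 is a sum of powers of s that determines b. *)
Let eps (i : 'I_m) (j : nat) := (choice.pickle (i, j)).+2.
Let alpha i j := s ^+ (eps i j - (i != i0)).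
Let lamp b : {poly k} := \sum_i 'X^(eps i (e b i)).
Let lam b : K := \sum_i s ^+ eps i (e b i).

(* The distracted family, sheared so that [x_i0] takes distinct values at its points. *)
Let N i : 'M[K]_n :=
  if i == i0 then distmx beta alpha i0 + s *: \sum_(j | j != i0) distmx beta alpha j
  else distmx beta alpha i.

Let lamE b : lam b = @tofrac {poly k} (lamp b).
Proof. by rewrite /lamp rmorph_sum; apply: eq_bigr => i _; rewrite rmorphXn. Qed.

Let eps_inj i j i' j' : eps i j = eps i' j' -> i = i' /\ j = j'.
Proof. by move=> [/(pcan_inj choice.pickleK)[-> ->]]. Qed.

Let lamp_coef b b' i : (lamp b)`_(eps i (e b' i)) = (e b i == e b' i)%:R.
Proof.
rewrite coef_sum (bigD1 i) //= coefXn big1 ?addr0 => [|i' i'i].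
  congr (_%:R); congr nat_of_bool; apply/eqP/eqP => [/eps_inj[]//|->//].
by rewrite coefXn; case: eqP => // /eps_inj[E]; rewrite E eqxx in i'i.
Qed.

Let lam_inj : injective lam.
Proof.
move=> b b'; rewrite !lamE => /eqP; rewrite tofrac_eq => /eqP E.
apply: hb_mon_inj; apply/mnmP => i; apply/eqP.
have := lamp_coef b b' i; rewrite E lamp_coef eqxx.
by case: eqP => // _ /esym/eqP; rewrite eq_sym oner_eq0.
Qed.

Let lam_neq0 b : lam b != 0.
Proof.
rewrite lamE tofrac_eq0; apply: contraTneq (oner_neq0 k) => l0.
by have := lamp_coef b b i0; rewrite l0 coef0 eqxx negbK => /esym/eqP.
Qed.

Let s_alpha i j : i != i0 -> s * alpha i j = s ^+ eps i j.
Proof. by move=> ii0; rewrite /alpha ii0 subn1 -exprS. Qed.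

Let N_comm i j : N i *m N j = N j *m N i.
Proof.
have C l l' : GRing.comm (distmx beta alpha l) (distmx beta alpha l').
  exact: (distmx_comm beta_closed).
have CN l l' : GRing.comm (distmx beta alpha l) (N l').
  rewrite /N; case: eqP => // _; apply: commrD => //.
  rewrite /GRing.comm -!mulmxE -scalemxAr -scalemxAl; congr (_ *: _).
  by apply: commr_sum => l2 _.
suff : GRing.comm (N j) (N i) by move/commr_sym.
rewrite {2}/N; case: eqP => [_|_]; last exact: commr_sym.
apply: commrD; first exact: commr_sym.
rewrite /GRing.comm -!mulmxE -scalemxAr -scalemxAl; congr (_ *: _).
by apply: commr_sum => l2 _; apply: commr_sym.
Qed.

Let W := evmx beta alpha.

Let W_N : W *m N i0 = diag_mx (\row_b lam b) *m W.
Proof.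
rewrite /N eqxx mulmxDr -scalemxAr mulmx_sumr evmx_distmx //.
under eq_bigr do rewrite evmx_distmx //.
rewrite -mulmx_suml scalemxAl -mulmxDl -/W; congr (_ *m _).
apply/matrixP => a b; rewrite [LHS]mxE [X in X + _]mxE [X in _ + X]mxE summxE [RHS]mxE.
have -> : \sum_(i | i != i0) diag_mx (\row_b alpha i (e b i)) a b =
    (\sum_(i | i != i0) alpha i (e a i)) *+ (a == b).
  by rewrite -sumrMnl; apply: eq_bigr => i _; rewrite !mxE.
rewrite mulrnAr mxE -mulrnDl mxE; congr (_ *+ _).
rewrite /lam [RHS](bigD1 i0) //=; congr (_ + _); first by rewrite /alpha eqxx subn0.
by rewrite mulr_sumr; apply: eq_bigr => i ii0; apply: s_alpha.
Qed.

Let kry : 'M[K]_n := \matrix_(a, j) (N i0 ^+ j *m delta_mx z 0) a (0 : 'I_1).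

(** Diagonalizing x_i0 turns the Krylov matrix into the Vandermonde matrix of the eigenvalues; as
    these are distinct, [W] and [kry] are both invertible. *)
Let W_kry : (W *m kry)^T = Vandermonde n (\row_b lam b).
Proof.
have WX j : W *m N i0 ^+ j = diag_mx (\row_b lam b ^+ j) *m W.
  elim: j => [|j IH].
    rewrite expr0 mulmx1 (_ : diag_mx _ = 1%:M) ?mul1mx //.
    by apply/matrixP => a b; rewrite !mxE expr0.
  rewrite exprSr -mulmxE mulmxA IH -mulmxA W_N mulmxA; congr (_ *m _).
  apply/matrixP => a b; rewrite mul_diag_mx !mxE exprSr.
  by case: eqP => [->|]; rewrite ?mulr1n // !mulr0n mulr0.
have Wz : W *m delta_mx z 0 = \col_b 1.
  rewrite -colE; apply/matrixP => b j; rewrite !mxE big1 // => i _.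
  by rewrite ez mnm0E big_ord0.
apply/matrixP => j b; rewrite [LHS]mxE [RHS]mxE [in RHS]mxE.
have -> : (W *m kry) b j = (W *m (N i0 ^+ j *m delta_mx z (0 : 'I_1))) b 0.
  by rewrite !mxE; apply: eq_bigr => a _; rewrite [X in _ * X]mxE.
by rewrite mulmxA WX -mulmxA Wz mul_diag_mx !mxE mulr1.
Qed.

Let W_kry_unit : W *m kry \in unitmx.
Proof.
rewrite unitmxE -det_tr W_kry det_Vandermonde unitfE.
apply/prodf_neq0 => i _; apply/prodf_neq0 => j ij; rewrite !mxE subr_eq0.
by rewrite (inj_eq lam_inj) neq_ltn ij orbT.
Qed.

Let uW : W \in unitmx.
Proof. by have := W_kry_unit; rewrite unitmx_mul => /andP[uW _]; exact: uW. Qed.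

Let ukry : kry \in unitmx.
Proof. by have := W_kry_unit; rewrite unitmx_mul => /andP[_ uk]; exact: uk. Qed.

Let val0_s : val0 s 0.
Proof. by have := @val0_poly k 'X; rewrite hornerX. Qed.

Let val0_mul0 j : val0 (s * s ^+ j) 0.
Proof.
have -> : s * s ^+ j = tofrac ('X ^+ j.+1) by rewrite rmorphXn exprS.
by have := val0_poly ('X^(j.+1) : {poly k}); rewrite hornerXn expr0n.
Qed.

Let val0_N i : val0_mx (N i) (shiftmx beta k i).
Proof.
have val0_alpha i' j : val0 (alpha i' j) 0.
  rewrite /alpha; have -> : (eps i' j - (i' != i0) = (eps i' j - (i' != i0)).-1.+1)%N.
    by rewrite /eps; case: (i' != i0); rewrite /= ?subn0 ?subn1.
  by rewrite exprS; exact: val0_mul0.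
have vd l : val0_mx (distmx beta alpha l) (shiftmx beta k l).
  move=> a b; rewrite mxE [in X in val0 X _]mxE -[X in val0 _ X]add0r; apply: val0D.
    by case: eqP => _; [apply: val0_alpha | apply: val0_0].
  rewrite !mxE; case: eqP => _; [exact: val0_1 | exact: val0_0].
rewrite /N; case: eqP => [->|_] // a b.
rewrite mxE -[X in val0 _ X]addr0; apply: val0D; first exact: vd.
rewrite mxE summxE -(mul0r (\sum_(j | j != i0) shiftmx beta k j a b)).
by apply: val0M => //; apply: val0_sum => j _; apply: vd.
Qed.

Let Q := monbasis N (delta_mx z 0).

(** At s = 0 every [alpha] vanishes, so distracted monomials become ordinary ones and the change of
    basis becomes trivial. *)
Let val0_Q : val0_mx Q 1%:M.
Proof.
rewrite -(monbasis_shiftmx beta_closed k ez) => a b; rewrite [Q _ _]mxE [X in val0 _ X]mxE.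
apply: val0_mxM; last first.
  by move=> i j; rewrite !mxE; case: (_ && _); [exact: val0_1 | exact: val0_0].
apply: (big_ind2 (@val0_mx k n n)); first exact: val0_mx1.
  by move=> *; apply: val0_mxM.
by move=> i _; apply: val0_mxX.
Qed.

Let uQ : Q \in unitmx.
Proof.
rewrite unitmxE unitfE; apply: contraNneq (oner_neq0 k) => d0.
by apply/eqP/val0_zero; rewrite -d0 -(det1 k n); apply: val0_det.
Qed.

(** The distracted family rewritten in the basis beta. The determinant of x_i0, a product of nonzero
    eigenvalues, is recorded because it vanishes at the limit and so shows that the curve is not
    constant. *)
Lemma curve : exists M : 'I_m -> 'M[K]_n,
  [/\ is_point M, krylov i0 M \in unitmx, \det (M i0) != 0
    & forall i, val0_mx (M i) (shiftmx beta k i)].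
Proof.
pose M i := invmx Q *m N i *m Q.
exists M; split.
- exact: (conj_is_point ez N_comm uQ).
- have -> : krylov i0 M = invmx Q *m kry.
    apply/matrixP => a j; rewrite mxE.
    have -> : M i0 ^+ j = invmx Q *m N i0 ^+ j *m Q.
      elim: (nat_of_ord j) => [|l IH]; first by rewrite !expr0 mulmx1 mulVmx.
      by rewrite !exprS IH -!mulmxE /M !mulmxA mulmxK.
    rewrite (unitcolE _ ez) -(mulmxA _ Q) monbasis_col ez.
    have -> : monmx N 0%MM = 1%:M by rewrite /monmx big1 // => i _; rewrite mnm0E.
    rewrite mul1mx -mulmxA !mxE; apply: eq_bigr => b _; congr (_ * _).
    by rewrite [RHS]mxE.
  by rewrite unitmx_mul unitmx_inv uQ ukry.
- rewrite (det_conjmx _ uQ).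
  rewrite (det_eigen uW W_N); apply/prodf_neq0 => b _; rewrite mxE; exact: lam_neq0.
move=> i; rewrite -[shiftmx beta k i]mulmx1 -[shiftmx beta k i]mul1mx -{1}(invmx1 k n).
apply: val0_mxM => //; apply: val0_mxM => //.
by apply: val0_invmx => //; apply: unitmx1.
Qed.

Lemma val0_pt_eval (M : 'I_m -> 'M[K]_n) :
  (forall i, val0_mx (M i) (shiftmx beta k i)) ->
  forall f, val0 (pt_eval (@tofrac {poly k} \o @polyC k) M f) f.@[hb_point k beta].
Proof.
move=> HM; elim/mpoly_ring_ind => [c|v|f g|f g].
- by rewrite pt_evalC mevalC; apply: val0C.
- have [[[i a] b] ->] : exists x : hb_V beta, v = enum_rank x.
    by exists (enum_val v); rewrite enum_valK.
  by rewrite [pt_eval _ _ _]pt_evalX mevalXU /hb_point enum_rankK; have := HM i a b; rewrite mxE.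
- by rewrite rmorphD mevalD; apply: val0D.
by rewrite rmorphM mevalM; apply: val0M.
Qed.

Lemma shiftmx_det : \det (shiftmx beta k i0) = 0.
Proof.
rewrite (expand_det_row _ z) big1 // => b _; rewrite mxE ez.
by rewrite mnmD_eq0 mnm1_eq0 andbF mul0r.
Qed.

End Curve.

(** * Dimension of the local ring *)

Section AlgebraicDependence.
Local Open Scope ring_scope.
Variables (k : fieldType) (D : nat) (K : fieldType) (xi : {rmorphism {mpoly k[D]} -> K}).
Variable delta : {mpoly k[D]}.
Hypothesis delta0 : xi delta != 0.

Let msizeM a b (f g : {mpoly k[D]}) :
  (msize f <= a.+1)%N -> (msize g <= b.+1)%N -> (msize (f * g) <= (a + b).+1)%N.
Proof.
move=> fa gb; have [->|f0] := eqVneq f 0; first by rewrite mul0r msize0.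
have [->|g0] := eqVneq g 0; first by rewrite mulr0 msize0.
by rewrite msizeM // -subn1 leq_subLR add1n -addSn -addnS leq_add.
Qed.

Let msizeX a (f : {mpoly k[D]}) i : (msize f <= a.+1)%N -> (msize (f ^+ i) <= (a * i).+1)%N.
Proof.
move=> fa; elim: i => [|i IH]; first by rewrite expr0 msize1 muln0.
by rewrite exprS mulnS; apply: msizeM.
Qed.

Let box_numerator d (g : nat -> K) :
  (forall j, (j < d)%N -> exists A G, xi delta ^+ A * g j = xi G) ->
  exists A B, forall n (e : box d n), exists H,
    (msize H <= (B * n).+1)%N /\ xi delta ^+ (A * n) * boxmon g e = xi H.
Proof.
elim: d g => [|d IH] g gP.
  by exists 0%N, 0%N => n e; exists 1; rewrite msize1 rmorph1 mulr1.
have [A0 [G0 G0P]] := gP 0%N isT.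
have [|A [B AB]] := IH (fun j => g j.+1); first by move=> j jd; apply: gP.
exists (A0 + A)%N, (msize G0 + msize delta * A0 + B)%N => n [i e].
have [H [HB HA]] := AB n e.
have le_in : (i <= n)%N := ltnW (ltn_ord i).
exists (G0 ^+ i * delta ^+ (A0 * (n - i)) * H); split.
  rewrite 2!mulnDl -mulnA; apply: msizeM => //; apply: msizeM.
    by apply: leq_trans (msizeX i (leqnSn _)) _; rewrite ltnS leq_mul2l le_in orbT.
  apply: leq_trans (msizeX _ (leqnSn _)) _.
  by rewrite ltnS leq_mul2l leq_mul2l leq_subr !orbT.
rewrite !rmorphM !rmorphXn -HA -G0P /= exprMn mulnDl exprD -exprM.
rewrite -{1}(subnK le_in) mulnDr exprD.
move: (xi delta ^+ (A0 * (n - i))) (xi delta ^+ (A0 * i)) (xi delta ^+ (A * n)) => a b c.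
move: (g 0%N ^+ i) (boxmon _ _) => u v.
ring.
Qed.

Lemma alg_dependent d (g : nat -> K) : (D < d)%N ->
  (forall j, (j < d)%N -> exists A G, xi delta ^+ A * g j = xi G) ->
  exists2 n, (0 < n)%N & exists a : box d n -> k,
    (exists e, a e != 0) /\ \sum_e xi (a e)%:MP * boxmon g e = 0.
Proof.
move=> Dd gP; have [A [B AB]] := box_numerator gP.
apply: NNPP => nodep.
(* Polynomials of degree at most B * n span at most (B n + 1)^D <= (B + 1)^D n^D dimensions; this is
   less than n^(D+1), hence less than the number n^d of box monomials. *)
pose n := (B.+1 ^ D).+1.
have [H HP] := choice _ (AB n).
have ind : indep_mod (fun f => xi f = 0) H.
  move=> a Ha e; apply: NNPP => ae; apply: nodep; exists n => //; exists a; split.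
    by exists e; apply/eqP.
  apply: (mulfI (expf_neq0 (A * n) delta0)); rewrite mulr0 -[RHS]Ha rmorph_sum mulr_sumr.
  by apply: eq_bigr => e' _; rewrite mulrCA (HP e').2 -mul_mpolyC rmorphM.
have : (#|box d n| <= #|{: 'X_{1..D < (B * n).+1}}|)%N.
  apply: (indep_span_card (v := fun m : 'X_{1..D < (B * n).+1} => 'X_[m] : {mpoly k[D]}) _ _ _ ind).
  - by move=> f g' f0 g0; rewrite rmorphD f0 g0 addr0.
  - by move=> c f f0; rewrite -mul_mpolyC rmorphM f0 mulr0.
  - exact: rmorph0.
  - move=> e; exists (fun m : 'X_{1..D < (B * n).+1} => (H e)@_m).
    by rewrite -mpolywE ?subrr ?rmorph0 //; case: (HP e).
rewrite card_box leqNgt => /negP; apply.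
apply: leq_ltn_trans (card_bmnm_le _ _) _.
apply: (@leq_ltn_trans ((B.+1 * n) ^ D)).
  have [D0|D0] := posnP D; first by rewrite D0.
  by rewrite leq_exp2r // mulSn -add1n leq_add2r.
rewrite expnMn; apply: (@leq_trans (n ^ D.+1)).
  by rewrite expnS ltn_pmul2r ?expn_gt0.
by rewrite leq_exp2l // ltnS expn_gt0.
Qed.

End AlgebraicDependence.

Section SmoothDimension.
Local Open Scope ring_scope.
Variables (k : fieldType) (m : nat) (beta : {fset 'X_{1..m}}).
Local Notation n := (hb_n beta).
Local Notation e := (@hb_mon m beta).
Local Notation R := {mpoly k[hb_N beta]}.
Local Notation Y := {mpoly k[par_dim beta]}.
Local Notation X := (@hb_mat k m beta).
Local Notation K := {fraction {poly k}}.

Lemma eq_pt_eval (L : comNzRingType) (iota iota' : {rmorphism k -> L}) (M M' : 'I_m -> 'M[L]_n) f :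
  iota =1 iota' -> M =1 M' -> pt_eval iota M f = pt_eval iota' M' f.
Proof.
move=> Ei EM; elim/mpoly_ring_ind: f => [c|v|f g Ef Eg|f g Ef Eg].
- by rewrite !pt_evalC.
- have [[[i a] b] ->] : exists x : hb_V beta, v = enum_rank x.
    by exists (enum_val v); rewrite enum_valK.
  by rewrite [LHS]pt_evalX [RHS]pt_evalX EM.
- by rewrite !rmorphD Ef Eg.
by rewrite !rmorphM Ef Eg.
Qed.

Lemma pt_eval_map (L : comNzRingType) (rho : {rmorphism R -> L}) f :
  pt_eval (rho \o @mpolyC _ k) (fun i => map_mx rho (X i)) f = rho f.
Proof.
elim/mpoly_ring_ind: f => [c|v|f g Ef Eg|f g Ef Eg].
- by rewrite pt_evalC.
- have [[[i a] b] ->] : exists x : hb_V beta, v = enum_rank x.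
    by exists (enum_val v); rewrite enum_valK.
  by rewrite [LHS]pt_evalX !mxE.
- by rewrite !rmorphD Ef Eg.
by rewrite !rmorphM Ef Eg.
Qed.

Variables (i0 : 'I_m) (z : 'I_n).
Hypothesis ez : e z = 0%MM.
Hypothesis beta_closed : forall a b : 'X_{1..m}, a \in beta -> (b <= a)%MM -> b \in beta.

Lemma par_hom_of_point (L : fieldType) (iota : {rmorphism k -> L}) (M : 'I_m -> 'M[L]_n) :
  is_point M -> krylov i0 M \in unitmx ->
  exists xi : {rmorphism Y -> L}, [/\ par_regular i0 xi, forall c, xi c%:MP = iota c
    & forall f, par_hom i0 xi f = pt_eval iota M f].
Proof.
move=> ptM uK; have [uQ EM] := par_surj z ptM uK.
pose y i a := krycoord i0 M i a 0.
pose xi : {rmorphism Y -> L} := mmap iota (fun v => y (enum_val v).1 (enum_val v).2).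
have Exi i a : xi (parX k i a) = y i a by rewrite /xi /parX /= mmapX mmap1U enum_rankK.
have EQ : parQ i0 (fun i a => xi (parX k i a)) = parQ i0 y.
  exact: eq_parQ.
have reg : par_regular i0 xi by rewrite par_regularP EQ.
exists xi; split=> // [c|f]; first exact: mmapC.
apply: eq_pt_eval => [c|i]; first exact: mmapC.
by rewrite -EM /parM EQ (eq_parN _ _ Exi).
Qed.

(* The curve is a specialization of the companion coordinates, so its local prime ideal
   avoids the Krylov determinant. *)
Lemma curve_hom : exists xi : {rmorphism Y -> K},
  [/\ par_regular i0 xi, forall c, xi c%:MP = @tofrac {poly k} c%:P,
      forall f, val0 (par_hom i0 xi f) f.@[hb_point k beta]
    & par_hom i0 xi (\det (X i0)) != 0].
Proof.
have [M [ptM uK dM vM]] := curve k i0 beta_closed ez.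
have [xi [reg xiC xiE]] := par_hom_of_point (@tofrac {poly k} \o @polyC k) ptM uK.
exists xi; split; [exact: reg | exact: xiC | move=> f | ].
  by rewrite xiE; apply: val0_pt_eval.
rewrite xiE -det_map_mx pt_eval_mat; exact: dM.
Qed.

Lemma det_hb_mat_point : (\det (X i0)).@[hb_point k beta] = 0.
Proof.
rewrite -det_map_mx -(shiftmx_det k i0 ez); congr (\det _).
by apply/matrixP => a b; rewrite !mxE /= mevalXU /hb_point enum_rankK.
Qed.

Lemma ker_prime (L : fieldType) N (rho : {rmorphism {mpoly k[N]} -> L}) :
  is_prime_ideal (fun f => rho f = 0).
Proof.
split; first split.
- exact: rmorph0.
- by move=> x y x0 y0; rewrite rmorphD x0 y0 addr0.
- by move=> a x x0; rewrite rmorphM x0 mulr0.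
- by rewrite rmorph1; apply/eqP/oner_neq0.
by move=> x y; rewrite rmorphM => /eqP; rewrite mulf_eq0 => /orP[] /eqP; [left|right].
Qed.

Lemma smooth_tangent_dim_le : smooth_basis_set k beta ->
  (tangent_dim (hb_equations k beta) (hb_point k beta) <= m * n)%N.
Proof.
move=> [[c [cprime cstep cF ctop]] _].
set t := tangent_dim _ _ in cprime cstep ctop *.
have [xi [reg xiC xiv xid]] := curve_hom.
have cP' f : c 0%N f -> par_hom i0 xi f = 0.
  apply: (smooth_chain_bottom cprime cstep cF ctop erefl (ker_prime (par_hom i0 xi))).
    by move=> g; apply: (par_hom_equations ez reg).
  by move=> g g0; apply: val0_zero; rewrite -g0; apply: xiv.
have [f fP] : exists f : nat -> R, forall j, (j < t)%N -> c j.+1 (f j) /\ ~ c j (f j).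
  apply: (choice (fun j f => (j < t)%N -> c j.+1 f /\ ~ c j f)) => j.
  by have [/cstep[_ [f fP]]|_] := boolP (j < t)%N; [exists f | exists 0].
have [|C C0 CP] := chain_indep cprime _ ctop (f := f).
  by move=> j jd; split; [apply: (cstep j jd).1 | apply: fP].
have [L [rho rhoP]] := residue_field (cprime _ (leq0n t)).
have ptrho : is_point (fun i => map_mx rho (X i)).
  by apply/hb_equationsP => g /cF/rhoP.
(* The Krylov determinant is nonzero along the curve, hence outside the smaller prime [c 0]. *)
have uK : krylov i0 (fun i => map_mx rho (X i)) \in unitmx.
  rewrite -map_krylov unitmxE det_map_mx unitfE; apply/eqP => /rhoP/cP'.
  by apply/eqP; apply: (par_hom_krylov ez reg).
have [eta [regL etaC etaE]] := par_hom_of_point (rho \o @mpolyC _ k) ptrho uK.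
have -> : (m * n = par_dim beta)%N by rewrite /par_dim card_prod !card_ord.
rewrite leqNgt; apply/negP => lt_t.
(* More than m * n separators [f j] would satisfy a nontrivial box relation in the residue field; it
   would lie in [c 0], against [chain_indep]. *)
have [|q q0 [a [[e' ae'] a0]]] := alg_dependent regL (g := fun j => rho (f j)) lt_t.
  move=> j _; have [A [G GP]] := par_hom_numerator i0 (f j).
  by exists A, G; rewrite -GP // etaE pt_eval_map.
move/eqP: ae'; apply; apply: (CP q q0).
apply: add_mpowW; apply/rhoP; rewrite rmorph_sum -[RHS]a0; apply: eq_bigr => x _.
rewrite -mul_mpolyC rmorphM etaC; congr (_ * _).
elim: t f x {cprime cstep ctop fP CP lt_t a a0 e'} => [|t IH] f x; first exact: rmorph1.
by rewrite /= rmorphM rmorphXn IH.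
Qed.

End SmoothDimension.

Lemma fractionP (A : idomainType) (w : {fraction A}) :
  (exists u d : A, d != 0 /\ tofrac d * w = tofrac u)%R.
Proof.
elim/quotW: w => w; exists (\n_w), (\d_w); split; first exact: denom_ratioP.
unlock tofrac; rewrite -[LHS]FracField.pi_mul; apply/eqmodP => /=.
by rewrite FracField.equivfE /FracField.mulf !numden_Ratio ?oner_eq0 ?mul1r ?mulr1 ?denom_ratioP.
Qed.

(** * A chain of primes of length m n at the monomial point *)

Section LongChain.
Local Open Scope ring_scope.
Variables (k : closedFieldType) (m : nat) (beta : {fset 'X_{1..m}}).
Local Notation n := (hb_n beta).
Local Notation e := (@hb_mon m beta).
Local Notation R := {mpoly k[hb_N beta]}.
Local Notation D := (par_dim beta).
Local Notation Y := {mpoly k[D]}.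
Local Notation X := (@hb_mat k m beta).
Local Notation K := {fraction {poly k}}.
Variables (i0 : 'I_m) (z : 'I_n).
Hypothesis ez : e z = 0%MM.
Hypothesis beta_closed : forall a b : 'X_{1..m}, a \in beta -> (b <= a)%MM -> b \in beta.

Local Notation iota := (@tofrac {poly k} \o @polyC k : {rmorphism k -> K}).
Local Notation delta := (\det (parQ i0 (parX k (beta := beta)))).

(** Over an algebraically closed field [q] splits, so its roots in k(s) already lie in k. *)
Lemma algebraic_const (x : K) (q : {poly k}) : q != 0 -> root (map_poly iota q) x ->
  exists c, x = iota c.
Proof.
move=> q0; have [r ->] := closed_field_poly_normal q.
rewrite map_polyZ rootZ; last by rewrite fmorph_eq0 lead_coef_eq0.
rewrite (rmorph_prod (map_poly iota)) /=.
rewrite (eq_bigr (fun c => 'X - (iota c)%:P)) => [|c _]; last first.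
  by rewrite rmorphB /= map_polyX map_polyC.
by rewrite -(big_map iota xpredT (fun c => 'X - c%:P)) root_prod_XsubC => /mapP[c _ ->]; exists c.
Qed.

Lemma val0_uniq (x : K) a b : val0 x a -> val0 x b -> a = b.
Proof.
move=> xa xb; apply/eqP; rewrite -subr_eq0; apply/eqP/val0_zero.
rewrite -(subrr x); apply: val0D xa _; rewrite -mulN1r -[- b]mulN1r; apply: val0M xb.
exact: (val0_sign k 1).
Qed.

Section Freeing.
Variable xi : {rmorphism Y -> K}.
Hypothesis reg : par_regular i0 xi.
Hypothesis xiC : forall c, xi c%:MP = iota c.

Let gamma v := xi 'X_v.

Let freed_exists (S : {set 'I_D}) : {phi : {rmorphism Y -> {mpoly K[D]}} |
  (forall c, phi c%:MP = (iota c)%:MP) /\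
  forall v, phi 'X_v = if v \in S then 'X_v else (gamma v)%:MP}.
Proof.
exists (mmap (@mpolyC D K \o iota) (fun v => if v \in S then 'X_v else (gamma v)%:MP)).
by split=> [c|v]; [exact: mmapC | rewrite /= mmapX mmap1U].
Qed.

(* The coordinates in [S] become independent variables, the others stay on the curve. *)
Definition freed S := sval (freed_exists S).

Let freedC S c : freed S c%:MP = (iota c)%:MP.
Proof. exact: (svalP (freed_exists S)).1. Qed.

Let freedX S v : freed S 'X_v = if v \in S then 'X_v else (gamma v)%:MP.
Proof. exact: (svalP (freed_exists S)).2. Qed.

Definition freedF S : {rmorphism Y -> {fraction {mpoly K[D]}}} :=
  @tofrac {mpoly K[D]} \o freed S.

Lemma freedF_eq0 S G : (freedF S G == 0) = (freed S G == 0).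
Proof. exact: tofrac_eq0. Qed.

(** Substituting the curve outside [S] factors through the substitution outside the larger set
    [S']. *)
Lemma freed_sub (S S' : {set 'I_D}) G : S \subset S' -> freed S' G = 0 -> freed S G = 0.
Proof.
move=> /subsetP SS'.
pose th : {rmorphism {mpoly K[D]} -> {mpoly K[D]}} :=
  mmap (@mpolyC D K) (fun v => if v \in S then 'X_v else (gamma v)%:MP).
suff E : freed S G = th (freed S' G) by rewrite E => ->; rewrite rmorph0.
elim/mpoly_ring_ind: G => [c|v|f g Ef Eg|f g Ef Eg].
- by rewrite !freedC /th /= mmapC.
- rewrite !freedX; case: (boolP (v \in S')) => vS'; last first.
    by rewrite (contraNF (SS' v) vS') /th /= mmapC.
  by rewrite /th /= mmapX mmap1U.
- by rewrite !rmorphD Ef Eg.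
by rewrite !rmorphM Ef Eg.
Qed.

Lemma freed0 G : freed set0 G = (xi G)%:MP.
Proof.
elim/mpoly_ring_ind: G => [c|v|f g Ef Eg|f g Ef Eg].
- by rewrite freedC xiC.
- by rewrite freedX inE.
- by rewrite !rmorphD Ef Eg.
by rewrite !rmorphM Ef Eg.
Qed.

Lemma freedF_regular S : par_regular i0 (freedF S).
Proof.
rewrite /par_regular freedF_eq0; apply: contra_neq reg => /(freed_sub (sub0set S)).
by rewrite freed0 => /eqP; rewrite mpolyC_eq0 => /eqP.
Qed.

(** k(s) has transcendence degree one: fractions in one variable fall under [alg_dependent] with D =
    1 and d = 2. *)
Lemma rational_relation x y : exists2 q, (0 < q)%N & exists a : box 2 q -> k,
  (exists t, a t != 0) /\ \sum_t iota (a t) * (x ^+ t.1 * y ^+ t.2.1) = 0.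
Proof.
pose eta : {rmorphism {mpoly k[1]} -> K} := mmap iota (fun=> @tofrac {poly k} 'X).
have lift u : exists G, eta G = @tofrac {poly k} u.
  elim/poly_ind: u => [|u c [G GP]]; first by exists 0; rewrite rmorph0 tofrac0.
  exists (G * 'X_ord0 + c%:MP).
  rewrite rmorphD rmorphM GP tofracD tofracM; congr (_ * _ + _).
    by rewrite /eta /= mmapX mmap1U.
  by rewrite /eta /= mmapC.
have [u1 [d1 [d10 E1]]] := fractionP x; have [u2 [d2 [d20 E2]]] := fractionP y.
have [G1 G1P] := lift u1; have [G2 G2P] := lift u2.
have [H1 H1P] := lift d1; have [H2 H2P] := lift d2.
have H0 : eta (H1 * H2) != 0 by rewrite rmorphM H1P H2P mulf_neq0 ?tofrac_eq0.
have [|q q0 [a [[t at0] a0]]] := alg_dependent H0 (d := 2) (g := fun j => if j is 0 then x else y) isT.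
  move=> [|j] _; [exists 1%N, (G1 * H2) | exists 1%N, (G2 * H1)].
    by rewrite expr1 !rmorphM G1P -E1 mulrAC H1P.
  by rewrite expr1 !rmorphM G2P -E2 H2P; ring.
exists q => //; exists a; split; first by exists t.
rewrite -[RHS]a0; apply: eq_bigr => -[i [j []]] _ /=.
by rewrite /eta /= mmapC mulr1.
Qed.

(** If all parameters of the curve were algebraic over k, they would be constants, and the
    determinant of x_i0 would be constant along the curve, equal to its value 0 at s = 0. *)
Lemma some_transcendental : par_hom i0 xi (\det (X i0)) != 0 ->
  (forall f, val0 (par_hom i0 xi f) f.@[hb_point k beta]) ->
  exists v, forall q : {poly k}, q != 0 -> ~~ root (map_poly iota q) (gamma v).
Proof.
move=> d0 xiv; apply: NNPP => notr.
have /choice[c cP] : forall v, exists c, gamma v = iota c.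
  move=> v; apply: NNPP => nc; apply: notr; exists v => q q0; apply/negP => rq.
  by apply: nc; apply: algebraic_const q0 rq.
have xiE G : xi G = iota G.@[c].
  elim/mpoly_ring_ind: G => [b|v|f g Ef Eg|f g Ef Eg].
  - by rewrite xiC mevalC.
  - by rewrite mevalXU -cP.
  - by rewrite rmorphD mevalD Ef Eg rmorphD.
  by rewrite rmorphM mevalM Ef Eg rmorphM.
have [A [G GP]] := par_hom_numerator i0 (\det (X i0)).
have := GP _ xi reg; rewrite !xiE -rmorphXn => E.
have dA : (\det (parQ i0 (parX k (beta := beta)))).@[c] ^+ A != 0.
  rewrite expf_neq0 //; have := reg; rewrite /par_regular xiE; apply: contra_neq => ->.
  by rewrite rmorph0.
have Ed : par_hom i0 xi (\det (X i0)) = iota (G.@[c] / delta.@[c] ^+ A).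
  apply: (mulfI (x := iota (delta.@[c] ^+ A))); first by rewrite fmorph_eq0.
  by rewrite E -rmorphM mulrC divfK.
have := xiv (\det (X i0)); rewrite (det_hb_mat_point k i0 ez) Ed => v0.
have b0 := val0_uniq v0 (val0C _).
by move/eqP: d0; apply; rewrite Ed -b0 rmorph0.
Qed.

Variable v0 : 'I_D.
Hypothesis v0P : forall q : {poly k}, q != 0 -> ~~ root (map_poly iota q) (gamma v0).

(** A relation between the values of v and v0 on the curve separates the two kernels. It holds while
    v stays on the curve; once v is free, each power of v would need a coefficient vanishing at the
    transcendental value of v0. *)
Lemma freed_strict (S : {set 'I_D}) v : v0 \notin S -> v \notin S -> v != v0 ->
  exists G, freed S G = 0 /\ freed (v |: S) G != 0.
Proof.
move=> v0S vS vv0.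
have [q q0 [a [[t at0] a0]]] := rational_relation (gamma v) (gamma v0).
exists (\sum_t (a t)%:MP * ('X_v ^+ t.1 * 'X_v0 ^+ t.2.1)).
have freedG S' : freed S' (\sum_t (a t)%:MP * ('X_v ^+ t.1 * 'X_v0 ^+ t.2.1)) =
    \sum_t (iota (a t))%:MP * (freed S' 'X_v ^+ t.1 * freed S' 'X_v0 ^+ t.2.1).
  rewrite rmorph_sum; apply: eq_bigr => t' _.
  by rewrite rmorphM freedC rmorphM !rmorphXn.
split.
  rewrite freedG !freedX (negPf v0S) (negPf vS) -[RHS]mpolyC0 -a0 rmorph_sum.
  by apply: eq_bigr => t' _; rewrite /= !mpolyCM !rmorphXn.
rewrite freedG !freedX !inE eqxx (negPf v0S) [v0 == v]eq_sym (negPf vv0) /=.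
apply: contraNneq at0 => G0.
pose b (i : 'I_q) : {poly k} := \sum_(j < q) a (i, (j, tt)) *: 'X^j.
have b0 i : b i = 0.
  apply/eqP; apply: contraTT isT => bi0; have /negP := v0P bi0; case.
  rewrite /root; apply/eqP.
  have /(congr1 (mcoeff (U_(v) *+ i)%MM)) := G0; rewrite mcoeff0 => <-.
  rewrite (rmorph_sum (map_poly iota)) horner_sum raddf_sum /=.
  have Et t' : ((iota (a t'))%:MP * ('X_v ^+ t'.1 * (gamma v0)%:MP ^+ t'.2.1))@_(U_(v) *+ i)%MM =
      if t'.1 == i then iota (a t') * gamma v0 ^+ t'.2.1 else 0.
    rewrite -rmorphXn /= mulrCA -mpolyCM mulrC mul_mpolyC mcoeffZ mcoeffXn.
    have -> : ((U_(v) *+ t'.1)%MM == (U_(v) *+ i)%MM) = (t'.1 == i).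
      apply/eqP/eqP => [/mnmP/(_ v)|->//].
      by rewrite !mulmnE !mnm1E eqxx !mul1n => /val_inj.
    by case: eqP => _; rewrite ?mulr1 ?mulr0.
  rewrite (eq_bigr _ (fun t' _ => Et t')) -big_mkcond /=.
  rewrite (reindex_onto (fun j : 'I_q => (i, (j, tt)) : box 2 q) (fun t' => t'.2.1)) /=; last first.
    by move=> [i' [j []]] /= /eqP ->.
  apply: eq_big => [j|j _]; first by rewrite !eqxx.
  by rewrite map_polyZ map_polyXn hornerZ hornerXn.
case: t => [i [j []]]; have /(congr1 (fun r : {poly k} => r`_j)) := b0 i.
rewrite coef0 coef_sum (bigD1 j) //= coefZ coefXn eqxx mulr1 big1 ?addr0 => [->//|j' jj'].
by rewrite coefZ coefXn eq_sym (inj_eq val_inj) (negPf jj') mulr0.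
Qed.

End Freeing.

Lemma long_chain : prime_chain_at (hb_equations k beta) (hb_point k beta) (m * n).
Proof.
have [xi [reg xiC xiv xid]] := curve_hom k i0 ez beta_closed.
have [v0 v0P] := some_transcendental reg xiC xid xiv.
have -> : (m * n = D)%N by rewrite /par_dim card_prod !card_ord.
(* [v0] is never freed, as its transcendental value makes each freeing strict. *)
pose r := rem v0 (enum 'I_D).
have sz : (size r = D.-1)%N by rewrite size_rem ?mem_enum // size_enum_ord.
pose S j : {set 'I_D} := [set v in take j r].
have v0r : v0 \notin r by rewrite mem_rem_uniqF ?enum_uniq.
have D0 : (0 < D)%N by apply: leq_ltn_trans (ltn_ord v0).
pose T j := par_hom i0 (freedF xi (S (D.-1 - j)%N)).
have regF := freedF_regular reg xiC.
have T_eq0 (S1 S2 : {set 'I_D}) : S1 \subset S2 -> forall f,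
    par_hom i0 (freedF xi S2) f = 0 -> par_hom i0 (freedF xi S1) f = 0.
  move=> S12; apply: (par_hom_ker (regF S2) (regF S1)).
  by move=> G /eqP; rewrite freedF_eq0 => /eqP/(freed_sub S12) G0; apply/eqP;
    rewrite freedF_eq0; apply/eqP.
have xiT : forall f, par_hom i0 (freedF xi (S 0%N)) f = 0 -> par_hom i0 xi f = 0.
  have S0 : S 0%N = set0 by apply/setP => v; rewrite !inE take0.
  apply: (par_hom_ker (regF _) reg); rewrite S0 => G /eqP.
  by rewrite freedF_eq0 (freed0 xiC) mpolyC_eq0 => /eqP.
have xi0 f : par_hom i0 xi f = 0 -> f.@[hb_point k beta] = 0.
  by move=> f0; apply: val0_zero; rewrite -f0; apply: xiv.
(* Primes grow as fewer parameters are free: D - 1 steps lead to the curve, and one more from the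
   curve to the point, separated by the determinant of x_i0. *)
exists (fun j f => if (j < D)%N then T j f = 0 else f.@[hb_point k beta] = 0); split.
- move=> j _; case: (j < D)%N; [exact: (ker_prime (T j)) | exact: (ker_prime (meval (hb_point k beta)))].
- move=> j jD; rewrite jD; case jD' : (j.+1 < D)%N.
    have Ej : (D.-1 - j = (D.-1 - j.+1).+1)%N by rewrite subnSK // -ltnS prednK.
    set i := (D.-1 - j.+1)%N in Ej.
    have ir : (i < size r)%N.
      by rewrite sz /i ltn_subrL /= -ltnS prednK //; apply: leq_ltn_trans jD'.
    have SS : S i.+1 = nth v0 r i |: S i.
      by apply/setP => v; rewrite !inE (take_nth v0) // mem_rcons inE.
    split=> [f|].
      by apply: T_eq0; rewrite /= -/i Ej SS subsetUr.
    have nth_r : nth v0 r i \in r by rewrite mem_nth.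
    have [|||G [G0 G1]] := @freed_strict xi v0 v0P (S i) (nth v0 r i).
    + by rewrite inE; apply: contra v0r => /mem_take.
    + have : uniq (take i.+1 r) by rewrite take_uniq // rem_uniq // enum_uniq.
      by rewrite (take_nth v0) // rcons_uniq inE => /andP[].
    + by apply: contraNneq v0r => <-.
    have F0 : freedF xi (S i) G = 0 by apply/eqP; rewrite freedF_eq0; apply/eqP.
    have F1 : freedF xi (S i.+1) G != 0 by rewrite freedF_eq0 SS.
    have [f [f0 f1]] := par_hom_ker_strict ez (regF (S i)) (regF (S i.+1)) F0 F1.
    exists f; rewrite /T -/i Ej; split; first exact: f0.
    exact/eqP.
  have Ej : (D.-1 - j = 0)%N.
    by apply/eqP; rewrite subn_eq0 -subn1 leq_subLR add1n leqNgt jD'.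
  split=> [f|]; first by rewrite /T Ej => /xiT/xi0.
  exists (\det (X i0)); split; first exact: det_hb_mat_point ez.
  by rewrite /T Ej => /xiT/eqP; apply/negP.
- by move=> f fF; rewrite D0; apply: (par_hom_equations ez).
by move=> f; rewrite ltnn.
Qed.

End LongChain.

(** * Tangent spaces of thickenings *)

Definition is_tangent (k : fieldType) (m : nat) (beta : {fset 'X_{1..m}})
    (v : 'rV[k]_(hb_N beta)) :=
  (v *m (jacobian_at (hb_equations k beta) (hb_point k beta))^T = 0)%R.

Section TangentVectors.
Local Open Scope ring_scope.
Variables (k : fieldType) (m : nat) (beta : {fset 'X_{1..m}}).
Local Notation n := (hb_n beta).
Local Notation e := (@hb_mon m beta).
Local Notation R := {mpoly k[hb_N beta]}.
Local Notation X := (@hb_mat k m beta).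
Local Notation p := (hb_point k beta).
Variable z : 'I_n.
Hypothesis ez : e z = 0%MM.
Hypothesis beta_closed : forall a b : 'X_{1..m}, a \in beta -> (b <= a)%MM -> b \in beta.

Definition rmon (A : pzRingType) (M : 'I_m -> A) (c : 'X_{1..m}) : A := \prod_(i < m) M i ^+ c i.

Section Direction.
Variable v : 'rV[k]_(hb_N beta).

Definition dirder (f : R) : k := \sum_i v 0 i * (f^`M(i)).@[p].

Lemma dirderD f g : dirder (f + g) = dirder f + dirder g.
Proof.
by rewrite /dirder -big_split; apply: eq_bigr => i _; rewrite mderivD mevalD mulrDr.
Qed.

Lemma dirder0 : dirder 0 = 0.
Proof. by rewrite /dirder big1 // => i _; rewrite mderiv0 meval0 mulr0. Qed.

Lemma dirderC c : dirder c%:MP = 0.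
Proof. by rewrite /dirder big1 // => i _; rewrite mderivC meval0 mulr0. Qed.

Lemma dirderN f : dirder (- f) = - dirder f.
Proof. by apply/eqP; rewrite -addr_eq0 -dirderD addNr dirder0. Qed.

Lemma dirder_nat (b : bool) : dirder b%:R = 0.
Proof. by case: b; rewrite ?dirder0 // -mpolyC1 dirderC. Qed.

Lemma dirderM f g : dirder (f * g) = dirder f * g.@[p] + f.@[p] * dirder g.
Proof.
rewrite /dirder mulr_suml mulr_sumr -big_split; apply: eq_bigr => i _ /=.
by rewrite mderivM mevalD !mevalM mulrDr mulrA [f.@[p] * (_ * _)]mulrCA.
Qed.

Lemma dirder_var i a b : dirder (hb_var k i a b) = v 0 (enum_rank (i, a, b)).
Proof.
rewrite /dirder (bigD1 (enum_rank (i, a, b))) //= big1 => [|j ji].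
  rewrite mderivX mnm1E eqxx scale1r addr0 (_ : (_ - _)%MM = 0%MM) ?mpolyX0 ?meval1 ?mulr1 //.
  by apply/mnmP => j; rewrite mnmBE subnn mnm0E.
by rewrite mderivX mnm1E eq_sym (negPf ji) scale0r meval0 mulr0.
Qed.

Lemma dirder_mxM r s t (A : 'M[R]_(r, s)) (B : 'M[R]_(s, t)) :
  map_mx dirder (A *m B) =
  map_mx dirder A *m map_mx (meval p) B + map_mx (meval p) A *m map_mx dirder B.
Proof.
apply/matrixP => i j; rewrite !mxE -big_split /= (big_morph dirder dirderD dirder0).
by apply: eq_bigr => l _; rewrite dirderM !mxE.
Qed.

Lemma dirder_mxB r s (A B : 'M[R]_(r, s)) :
  map_mx dirder (A - B) = map_mx dirder A - map_mx dirder B.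
Proof. by apply/matrixP => i j; rewrite !mxE dirderD dirderN. Qed.

(* First-order arithmetic at [p]: a matrix over the dual numbers [A + eps A'] is
   represented by the block matrix [[A, 0], [A', A]]. *)
Definition dualmx (A : 'M[R]_n) : 'M[k]_(n + n) :=
  block_mx (map_mx (meval p) A) 0 (map_mx dirder A) (map_mx (meval p) A).

Definition dualcol (A : 'cV[R]_n) : 'cV[k]_(n + n) :=
  col_mx (map_mx (meval p) A) (map_mx dirder A).

Lemma dualmxM A B : dualmx (A *m B) = dualmx A *m dualmx B.
Proof.
by rewrite /dualmx mulmx_block !mulmx0 !mul0mx !addr0 add0r dirder_mxM map_mxM.
Qed.

Lemma dualmx1 : dualmx 1%:M = 1%:M.
Proof.
rewrite /dualmx map_mx1 (_ : map_mx dirder 1%:M = 0) -?scalar_mx_block //.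
by apply/matrixP => a b; rewrite !mxE dirder_nat.
Qed.

Lemma dualmx_mon c : dualmx (hb_matmon k beta c) = rmon (fun i => dualmx (X i)) c.
Proof.
have dM : {morph dualmx : A B / (A * B)%R >-> (A * B)%R} by exact: dualmxM.
rewrite /hb_matmon /rmon (big_morph dualmx dM dualmx1); apply: eq_bigr => i _.
by elim: (c i) => [|j IH]; [exact: dualmx1 | rewrite !exprS dM IH].
Qed.

Lemma dualmx_col A c : dualcol (A *m c) = dualmx A *m dualcol c.
Proof. by rewrite /dualcol /dualmx mul_block_col mul0mx addr0 dirder_mxM map_mxM. Qed.

Definition tangentmx i : 'M[k]_n := \matrix_(a, b) v 0 (enum_rank (i, a, b)).

Definition dualpt i : 'M[k]_(n + n) :=
  block_mx (shiftmx beta k i) 0 (tangentmx i) (shiftmx beta k i).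

Lemma dualmx_hb_mat i : dualmx (X i) = dualpt i.
Proof.
by congr block_mx; apply/matrixP => a b; rewrite !mxE ?dirder_var //= mevalXU /hb_point enum_rankK.
Qed.

Lemma shiftmx_is_point : is_point (shiftmx beta k).
Proof.
split=> [i j|b].
  by apply/matrixP => a b; rewrite !shiftmxM // -!addmA [(U_(j) + _)%MM]addmC.
have /(congr1 (mulmx^~ (delta_mx b (0 : 'I_1)))) := monbasis_shiftmx beta_closed k ez.
by rewrite monbasis_col mul1mx (unitcolE k ez).
Qed.

Lemma hb_equations_point f : f \in hb_equations k beta -> f.@[p] = 0.
Proof.
apply: (proj2 (hb_equationsP (meval p))).
apply: eq_is_point shiftmx_is_point => i.
by apply/matrixP => a b; rewrite !mxE /= mevalXU /hb_point enum_rankK.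
Qed.

(** Tangent vectors are points over the dual numbers. The value part of the equations holds at the
    monomial point, so only the derivative block is a condition. *)
Lemma tangentP : is_tangent v <->
  (forall i j, dualpt i *m dualpt j = dualpt j *m dualpt i) /\
  (forall b, rmon dualpt (e b) *m col_mx (delta_mx z 0) 0 = col_mx (delta_mx b (0 : 'I_1)) 0).
Proof.
set F := hb_equations k beta.
have JE : is_tangent v <-> forall f, f \in F -> dirder f = 0.
  rewrite /is_tangent -/F; have E r : (v *m (jacobian_at F p)^T) 0 r = dirder (nth 0 F r).
    by rewrite mxE; apply: eq_bigr => i _; rewrite !mxE.
  split=> [J0 f fF|H].
    have rP : (index f F < size F)%N by rewrite index_mem.
    by have := E (Ordinal rP); rewrite J0 mxE /= nth_index.
  by apply/matrixP => i r; rewrite ord1 E H ?mem_nth // mxE.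
pose E1 i j := X i *m X j - X j *m X i.
pose E2 b := hb_matmon k beta (e b) *m hb_e1 k beta - delta_mx b 0.
have E1F i j a b : E1 i j a b \in F.
  rewrite mem_cat; apply/orP; left.
  by apply/allpairsP; exists ((i, j), (a, b)); rewrite !mem_enum.
have E2F b a : E2 b a 0 \in F.
  rewrite mem_cat; apply/orP; right.
  by apply/allpairsP; exists (b, a); rewrite !mem_enum.
have dualE1 i j : dualpt i *m dualpt j - dualpt j *m dualpt i = dualmx (E1 i j).
  rewrite -!dualmx_hb_mat -!dualmxM /dualmx /E1 opp_block_mx add_block_mx.
  by rewrite dirder_mxB map_mxB oppr0 addr0.
have dual_e1 : dualcol (hb_e1 k beta) = col_mx (delta_mx z 0) 0.
  rewrite /dualcol; congr col_mx.
    by rewrite -(unitcolE k ez) -(map_unitcol beta (meval p)).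
  by apply/matrixP => a b; rewrite !mxE dirder_nat.
have dualE2 b : rmon dualpt (e b) *m col_mx (delta_mx z 0) 0 - col_mx (delta_mx b (0 : 'I_1)) 0
    = dualcol (E2 b).
  rewrite -dual_e1 (_ : rmon dualpt (e b) = dualmx (hb_matmon k beta (e b))); last first.
    by rewrite dualmx_mon; apply: eq_bigr => i _; rewrite dualmx_hb_mat.
  rewrite -dualmx_col /dualcol /E2 opp_col_mx add_col_mx dirder_mxB map_mxB.
  congr (col_mx (_ - _) _); first by rewrite map_delta_mx.
  by apply/matrixP => a c; rewrite !mxE dirder_nat.
rewrite JE; split=> [H|[cD mD] f].
  split=> [i j|b]; apply/eqP; rewrite -subr_eq0.
    rewrite dualE1 /dualmx block_mx_eq0; apply/and4P; split=> //;
      apply/eqP/matrixP => a b; rewrite [LHS]mxE [RHS]mxE;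
      [apply: hb_equations_point | apply: H | apply: hb_equations_point]; exact: E1F.
  rewrite dualE2 /dualcol col_mx_eq0; apply/andP; split;
      apply/eqP/matrixP => a c; rewrite [LHS]mxE [RHS]mxE ord1;
      [apply: hb_equations_point | apply: H]; exact: E2F.
rewrite mem_cat => /orP[] /allpairsP.
  case=> -[[i j] [a b]] [_ _ ->] /=; have /esym/eqP := dualE1 i j; rewrite cD subrr block_mx_eq0.
  by case/and4P => _ _ /eqP/matrixP/(_ a b); rewrite mxE [RHS]mxE.
case=> -[b a] [_ _ ->] /=; have /esym/eqP := dualE2 b; rewrite mD subrr col_mx_eq0.
by case/andP => _ /eqP/matrixP/(_ a 0); rewrite mxE [RHS]mxE.
Qed.

End Direction.
End TangentVectors.

Lemma rmonD m (A : pzRingType) (M : 'I_m -> A) (a c : 'X_{1..m}) :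
  (forall i j, M i * M j = M j * M i)%R -> rmon M (a + c)%MM = (rmon M a * rmon M c)%R.
Proof.
move=> cM; rewrite /rmon -prodrM_comm => [|i j _ _]; last first.
  by apply: commrX; apply: commr_sym; apply: commrX; apply: cM.
by apply: eq_bigr => i _; rewrite mnmDE exprD.
Qed.

Lemma rmonU m (A : pzRingType) (M : 'I_m -> A) i : rmon M U_(i)%MM = M i.
Proof.
rewrite /rmon (big_only1 i) //= ?mnm1E ?eqxx ?expr1 // => j ji _.
by rewrite mnm1E eq_sym (negPf ji) expr0.
Qed.

Section Thickening.
Local Open Scope ring_scope.
Variables (k : fieldType) (m : nat) (beta0 : {fset 'X_{1..m}}) (w : nat).
Variable beta : {fset 'X_{1..m.+1}}.
Hypothesis beta0_basis : basis_set beta0.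
Hypothesis w0 : (0 < w)%N.
Hypothesis betaE : forall c : 'X_{1..m.+1},
  (c \in beta) = (mnm_front c \in beta0) && (c ord_max < w)%N.
Local Notation n := (hb_n beta).
Local Notation n0 := (hb_n beta0).
Local Notation e := (@hb_mon m.+1 beta).
Local Notation e0 := (@hb_mon m beta0).
Local Notation wd := (widen_ord (leqnSn m)).

Let beta0_closed := beta0_basis.2.

Definition mnm_ext (b : 'X_{1..m}) s : 'X_{1..m.+1} :=
  [multinom if unlift ord_max i is Some j then b j else s | i < m.+1].

Lemma mnm_ext_wd b s j : mnm_ext b s (wd j) = b j.
Proof.
have -> : wd j = lift ord_max j by apply: ord_inj; rewrite lift_max.
by rewrite mnmE liftK.
Qed.

Lemma mnm_ext_max b s : mnm_ext b s ord_max = s.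
Proof. by rewrite mnmE unlift_none. Qed.

Lemma mnm_extP (c c' : 'X_{1..m.+1}) :
  (forall j, c (wd j) = c' (wd j)) -> c ord_max = c' ord_max -> c = c'.
Proof.
move=> H Hm; apply/mnmP => i; case: (unliftP ord_max i) => [j ->|-> //].
have -> : lift ord_max j = wd j by apply: ord_inj; rewrite lift_max.
exact: H.
Qed.

Lemma front_ext b s : mnm_front (mnm_ext b s) = b.
Proof. by apply/mnmP => j; rewrite mnmE mnm_ext_wd. Qed.

Lemma ext_front c : mnm_ext (mnm_front c) (c ord_max) = c.
Proof. by apply: mnm_extP => [j|]; rewrite ?mnm_ext_wd ?mnm_ext_max ?mnmE. Qed.

Lemma ext_inj b s b' s' : mnm_ext b s = mnm_ext b' s' -> b = b' /\ s = s'.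
Proof.
move=> E; split; first by rewrite -(front_ext b s) E front_ext.
by rewrite -(mnm_ext_max b s) E mnm_ext_max.
Qed.

Lemma ext_eq b s b' s' : (mnm_ext b s == mnm_ext b' s') = (b == b') && (s == s').
Proof. by apply/eqP/andP => [/ext_inj[-> ->] //|[/eqP-> /eqP->]]. Qed.

Lemma wd_max j : (wd j == ord_max) = false.
Proof. by apply/negbTE/eqP => /(congr1 val) /= E; have := ltn_ord j; rewrite E ltnn. Qed.

Lemma ext_addU b s i : (mnm_ext b s + U_(wd i))%MM = mnm_ext (b + U_(i))%MM s.
Proof.
apply: mnm_extP => [j|]; rewrite mnmDE mnm1E ?mnm_ext_wd ?mnm_ext_max.
  by rewrite mnmDE mnm1E.
by rewrite wd_max addn0.
Qed.

Lemma ext_addmax b s : (mnm_ext b s + U_(ord_max))%MM = mnm_ext b s.+1.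
Proof.
apply: mnm_extP => [j|]; rewrite mnmDE mnm1E ?mnm_ext_wd ?mnm_ext_max.
  by rewrite eq_sym wd_max addn0.
by rewrite eqxx addn1.
Qed.

Lemma mem_ext b s : (mnm_ext b s \in beta) = (b \in beta0) && (s < w)%N.
Proof. by rewrite betaE front_ext mnm_ext_max. Qed.

Lemma thick_basis_set : basis_set beta.
Proof.
split.
  have /fset0Pn[b bb] := beta0_basis.1.
  by apply/fset0Pn; exists (mnm_ext b 0); rewrite mem_ext bb.
move=> a b; rewrite !betaE => /andP[fa aw] /mnm_lepP ba; apply/andP; split.
  by apply: beta0_closed fa _; apply/mnm_lepP => j; rewrite !mnmE.
exact: leq_ltn_trans (ba _) aw.
Qed.

Let beta_closed := thick_basis_set.2.

Let idx_in (a : 'I_n0) (s : 'I_w) : mnm_ext (e0 a) s \in beta.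
Proof. by rewrite mem_ext hb_mon_in ltn_ord. Qed.

Definition thick_idx a s : 'I_n := enum_rank [` idx_in a s]%fset.
Local Notation idx := thick_idx.

Lemma thick_idxE a s : e (idx a s) = mnm_ext (e0 a) s.
Proof. by rewrite /hb_mon enum_rankK. Qed.

Lemma thick_idx_eq a s a' s' : (idx a s == idx a' s') = (a == a') && (s == s').
Proof.
by rewrite -(inj_eq (@hb_mon_inj _ beta)) !thick_idxE ext_eq (inj_eq (@hb_mon_inj _ beta0)).
Qed.

Lemma thick_idxP b : exists a s, b = idx a s.
Proof.
have := hb_mon_in b; rewrite betaE => /andP[/hb_monP[a ea] sw].
exists a, (Ordinal sw); apply: hb_mon_inj; rewrite thick_idxE ea /=.
by rewrite ext_front.
Qed.

Lemma thick_card : n = (n0 * w)%N.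
Proof.
have inj : injective (fun x : 'I_n0 * 'I_w => idx x.1 x.2).
  by move=> [a s] [a' s'] /eqP; rewrite thick_idx_eq => /andP[/eqP /= -> /eqP ->].
have := card_codom inj; rewrite card_prod !card_ord => <-.
rewrite -[LHS]card_ord; apply: eq_card => b; rewrite !inE; apply/esym/codomP.
by have [a [s ->]] := thick_idxP b; exists (a, s).
Qed.

Let s0 : 'I_w := Ordinal w0.

(** Multiplication by x_r^s, from the algebra of beta0 into that of beta; the transpose extracts the
    x_r^s component. Both are linear over the polynomials in the first variables. *)
Definition thick_incl s : 'M[k]_(n, n0) := \matrix_(b, a) (b == idx a s)%:R.
Local Notation J := thick_incl.
Local Notation S := (shiftmx beta k).
Local Notation S0 := (shiftmx beta0 k).

Lemma thick_incl_orth s s' : (J s)^T *m J s' = (s == s')%:R%:M.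
Proof.
apply/matrixP => a a'; rewrite !mxE (bigD1 (idx a s)) //= !mxE eqxx mul1r thick_idx_eq.
rewrite big1 ?addr0 => [|b /negPf ba]; last by rewrite !mxE ba mul0r.
by rewrite andbC; case: eqP; rewrite ?mul0rn ?andTb.
Qed.

Lemma shift_incl i s : S (wd i) *m J s = J s *m S0 i.
Proof.
apply/matrixP => b a; have [a' [s' ->]] := thick_idxP b.
rewrite !mxE (bigD1 (idx a s)) //= !mxE eqxx mulr1 big1 ?addr0 => [|c /negPf ca]; last first.
  by rewrite !mxE ca mulr0.
rewrite (bigD1 a') //= !mxE thick_idx_eq eqxx /= [X in _ + X]big1 ?addr0 => [|c /negPf ca]; last first.
  by rewrite !mxE thick_idx_eq [a' == c]eq_sym ca mul0r.
rewrite !thick_idxE ext_addU ext_eq [_ == val s']eq_sym andbC.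
by rewrite -[val s' == val s]/(s' == s); case: (s' == s); rewrite ?mul1r ?mul0r.
Qed.

Lemma incl_shift i s : (J s)^T *m S (wd i) = S0 i *m (J s)^T.
Proof.
apply/matrixP => a b; have [a' [s' ->]] := thick_idxP b.
rewrite !mxE (bigD1 (idx a s)) //= !mxE eqxx mul1r big1 ?addr0 => [|c /negPf ca]; last first.
  by rewrite !mxE ca mul0r.
rewrite (bigD1 a') //= !mxE thick_idx_eq eqxx /= [X in _ + X]big1 ?addr0 => [|c /negPf ca]; last first.
  by rewrite !mxE thick_idx_eq [a' == c]eq_sym ca mulr0.
rewrite !thick_idxE ext_addU ext_eq.
by rewrite -[val s' == val s]/(s' == s); case: (s' == s); rewrite ?andbT ?andbF ?mulr1 ?mulr0.
Qed.

Variable z0 : 'I_n0.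
Hypothesis ez0 : e0 z0 = 0%MM.
Let z := idx z0 s0.

Lemma thick_zero : e z = 0%MM.
Proof. by rewrite thick_idxE ez0; apply: mnm_extP => [j|]; rewrite ?mnm_ext_wd ?mnm_ext_max !mnm0E. Qed.

Lemma incl_entry (A : 'M[k]_n) s s' a b :
  ((J s)^T *m A *m J s') a b = A (idx a s) (idx b s').
Proof.
rewrite mxE (bigD1 (idx b s')) //= !mxE eqxx mulr1 [X in _ + X]big1 ?addr0 => [|c /negPf cb]; last first.
  by rewrite [J s' _ _]mxE cb mulr0.
rewrite (bigD1 (idx a s)) //= !mxE eqxx mul1r big1 ?addr0 // => c /negPf ca.
by rewrite !mxE ca mul0r.
Qed.

(** Acts on tangent coordinates: it keeps the x_r^s component of the derivatives of the first m
    matrices on monomials free of x_r. *)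
Definition sub_dir s : 'M[k]_(hb_N beta, hb_N beta0) :=
  \matrix_(u, u0) let: (i, a, b) := enum_val u0 in
    (u == enum_rank ((wd i, idx a s, idx b s0) : hb_V beta))%:R.

(** [rev_ord s0] is w - 1: the derivative of x_r on x_r^(w-1) gives, up to sign, the value of the
    tangent homomorphism on x_r^w. *)
Definition last_dir : 'M[k]_(hb_N beta, n) :=
  \matrix_(u, a) (u == enum_rank ((ord_max, a, idx z0 (rev_ord s0)) : hb_V beta))%:R.

Section Direction.
Variable v : 'rV[k]_(hb_N beta).

Lemma tangentmx_sub s i :
  tangentmx (v *m sub_dir s) i = (J s)^T *m tangentmx v (wd i) *m J s0.
Proof.
apply/matrixP => a b; rewrite incl_entry [LHS]mxE [RHS]mxE mxE.
rewrite (bigD1 (enum_rank ((wd i, idx a s, idx b s0) : hb_V beta))) //= mxE enum_rankK eqxx mulr1.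
by rewrite big1 ?addr0 // => u /negPf uu; rewrite mxE enum_rankK uu mulr0.
Qed.

Lemma last_dirE a :
  (v *m last_dir) 0 a = tangentmx v ord_max a (idx z0 (rev_ord s0)).
Proof.
rewrite [RHS]mxE mxE (bigD1 (enum_rank ((ord_max, a, idx z0 (rev_ord s0)) : hb_V beta))) //=.
by rewrite mxE eqxx mulr1 big1 ?addr0 // => u /negPf uu; rewrite mxE uu mulr0.
Qed.

Hypothesis vT : is_tangent v.
Let P := dualpt v.

Let vP := (tangentP thick_zero beta_closed v).1 vT.
Let cP : forall i j, P i *m P j = P j *m P i := vP.1.
(** The monomial c applied to 1 over the dual numbers. For c outside beta the derivative part is, up
    to sign, the image of c under the tangent homomorphism. *)
Let Phi c : 'cV[k]_(n + n) := rmon P c *m col_mx (delta_mx z 0) 0.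

Let PhiD a c : Phi (a + c)%MM = rmon P a *m Phi c.
Proof. by rewrite /Phi rmonD // -mulmxE mulmxA. Qed.

Let Phi_basis b : Phi (e b) = col_mx (delta_mx b 0) 0.
Proof. exact: vP.2. Qed.

Let P_delta i b : P i *m col_mx (delta_mx b (0 : 'I_1)) 0 =
  col_mx (S i *m delta_mx b 0) (tangentmx v i *m delta_mx b 0).
Proof. by rewrite /P /dualpt mul_block_col !mulmx0 !addr0. Qed.

(* The component along [x_r ^ s] of the restriction to the monomials free of [x_r]:
   [block (J s0, 1)] and [block (1, (J s)^T)] intertwine the two dual-number actions. *)
Lemma sub_dir_tangent s : is_tangent (v *m sub_dir s).
Proof.
set u := v *m sub_dir s; pose Q := dualpt u.
(* An intermediate action, with values in the algebra of beta0 and derivatives in that of beta. [I1]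
   embeds it into the action for beta and [I2] maps it onto the one for beta0, so the relations pass
   through it. *)
pose T i : 'M[k]_(n0 + n) := block_mx (S0 i) 0 (tangentmx v (wd i) *m J s0) (S (wd i)).
pose I1 : 'M[k]_(n + n, n0 + n) := block_mx (J s0) 0 0 1%:M.
pose I2 : 'M[k]_(n0 + n0, n0 + n) := block_mx 1%:M 0 0 (J s)^T.
have PI i : P (wd i) *m I1 = I1 *m T i.
  rewrite /P /dualpt /I1 /T !mulmx_block !mulmx0 !mul0mx !mulmx1 !mul1mx !addr0 !add0r.
  by rewrite shift_incl.
have QI i : I2 *m T i = Q i *m I2.
  rewrite /Q /dualpt /I2 /T !mulmx_block !mulmx0 !mul0mx !mulmx1 !mul1mx !addr0 !add0r.
  by rewrite incl_shift tangentmx_sub mulmxA.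
have I1K : (block_mx (J s0)^T 0 0 1%:M : 'M[k]_(n0 + n, n + n)) *m I1 = 1%:M.
  rewrite /I1 mulmx_block !mulmx0 !mul0mx !mulmx1 !addr0 !add0r thick_incl_orth eqxx.
  by rewrite -scalar_mx_block.
have I2K : I2 *m (block_mx 1%:M 0 0 (J s) : 'M[k]_(n0 + n, n0 + n0)) = 1%:M.
  rewrite /I2 mulmx_block !mulmx0 !mul0mx !mulmx1 !addr0 !add0r thick_incl_orth eqxx.
  by rewrite -scalar_mx_block.
have cT i j : T i *m T j = T j *m T i.
  have : I1 *m (T i *m T j) = I1 *m (T j *m T i).
    by rewrite !mulmxA -!PI -!mulmxA -!PI !mulmxA cP.
  by move/(congr1 (mulmx (block_mx (J s0)^T 0 0 1%:M))); rewrite !(mulmxA _ I1) I1K !mul1mx.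
apply/(tangentP ez0 beta0_closed); split=> [i j|b].
  have : (Q i *m Q j) *m I2 = (Q j *m Q i) *m I2.
    by rewrite -!mulmxA -!QI !mulmxA -!QI -!mulmxA cT.
  by move/(congr1 (mulmx^~ (block_mx 1%:M 0 0 (J s)))); rewrite -!(mulmxA _ I2) I2K !mulmx1.
have rT c : rmon P (mnm_ext c 0) *m I1 = I1 *m rmon T c.
  rewrite /rmon big_ord_recr /= mnm_ext_max expr0 mulr1.
  apply: (big_ind2 (fun A B => A *m I1 = I1 *m B)).
  - by rewrite mul1mx mulmx1.
  - by move=> A B A' B' E E'; rewrite -!mulmxE -mulmxA E' mulmxA E mulmxA.
  move=> i _; rewrite mnm_ext_wd; elim: (c i) => [|j IH]; first by rewrite mul1mx mulmx1.
  by rewrite !exprS -!mulmxE -mulmxA IH mulmxA PI mulmxA.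
have rQ c : I2 *m rmon T c = rmon Q c *m I2.
  apply: (big_ind2 (fun A B => I2 *m A = B *m I2)).
  - by rewrite mul1mx mulmx1.
  - by move=> A B A' B' E E'; rewrite -!mulmxE mulmxA E -mulmxA E' mulmxA.
  move=> i _; elim: (c i) => [|j IH]; first by rewrite mul1mx mulmx1.
  by rewrite !exprS -!mulmxE mulmxA QI -mulmxA IH mulmxA.
have Jdelta a : J s0 *m delta_mx a 0 = delta_mx (idx a s0) (0 : 'I_1).
  by rewrite -colE; apply/matrixP => c j; rewrite !mxE ord1 andbT.
have TE : rmon T (e0 b) *m col_mx (delta_mx z0 (0 : 'I_1)) 0 = col_mx (delta_mx b 0) 0.
  have : I1 *m (rmon T (e0 b) *m col_mx (delta_mx z0 (0 : 'I_1)) 0) = I1 *m col_mx (delta_mx b 0) 0.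
    rewrite mulmxA -rT -mulmxA {2}/I1 !mul_block_col !mulmx0 !mul0mx !addr0 !Jdelta.
    by have := Phi_basis (idx b s0); rewrite thick_idxE.
  by move/(congr1 (mulmx (block_mx (J s0)^T 0 0 1%:M))); rewrite !(mulmxA _ I1) I1K !mul1mx.
have I2delta a : I2 *m col_mx (delta_mx a (0 : 'I_1)) 0 = col_mx (delta_mx a 0) 0.
  by rewrite /I2 mul_block_col !mulmx0 !mul0mx mul1mx !addr0.
by rewrite -[X in _ *m X = _]I2delta mulmxA -rQ -mulmxA TE I2delta.
Qed.

Hypothesis v_sub : forall s, v *m sub_dir s = 0.
Hypothesis v_last : v *m last_dir = 0.

Let P_front i a : P (wd i) *m col_mx (delta_mx (idx a s0) (0 : 'I_1)) 0 =
  col_mx (S (wd i) *m delta_mx (idx a s0) 0) 0.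
Proof.
rewrite P_delta; congr col_mx; rewrite -colE; apply/matrixP => b j; rewrite mxE [RHS]mxE.
have [a' [s ->]] := thick_idxP b.
by rewrite -incl_entry -tangentmx_sub v_sub !mxE.
Qed.

Let S_out i b : (e b + U_(i))%MM \notin beta -> S i *m delta_mx b (0 : 'I_1) = 0.
Proof.
move=> bi; rewrite -colE; apply/matrixP => a j; rewrite !mxE.
by case: eqP => // E; case/negP: bi; rewrite E hb_mon_in.
Qed.

(** Induction on the degree reduces to a variable times a monomial of beta0, where the derivative is
    read off [sub_dir]. *)
Let Phi_front_out (c : 'X_{1..m}) : c \notin beta0 -> Phi (mnm_ext c 0) = 0.
Proof.
have [d] := ubnP (mdeg c); elim: d c => // d IH c; rewrite ltnS => cd nc.
have c0 : c != 0%MM by apply: contraNneq nc => ->; rewrite -ez0 hb_mon_in.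
have [i ci] : exists i, (U_(i) <= c)%MM.
  apply: NNPP => nci; move/eqP: c0; apply; apply/mnmP => i; rewrite mnm0E; apply/eqP.
  by apply: contraT => ci; case: nci; exists i; rewrite lep1mP.
have Ec : mnm_ext c 0 = (U_(wd i) + mnm_ext (c - U_(i))%MM 0)%MM.
  by rewrite addmC ext_addU submK.
rewrite Ec PhiD rmonU; have [cb|cb] := boolP ((c - U_(i))%MM \in beta0); last first.
  rewrite IH ?mulmx0 // (leq_trans _ cd) // -{2}(submK ci) mdegD mdeg1 addn1.
  exact: leqnn.
have [a ea] := hb_monP cb.
have -> : mnm_ext (c - U_(i))%MM 0 = e (idx a s0) by rewrite thick_idxE ea.
rewrite Phi_basis P_front S_out ?col_mx0 // thick_idxE ea ext_addU submK //.
by rewrite mem_ext (negPf nc).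
Qed.

Let Phi_out c : c \notin beta -> Phi c = 0.
Proof.
move=> nc; have Ec j : mnm_ext (mnm_front c) j = (mnm_ext 0 j + mnm_ext (mnm_front c) 0)%MM.
  by apply: mnm_extP => [i|]; rewrite mnmDE ?mnm_ext_wd ?mnm_ext_max ?mnm0E ?add0n ?addn0.
have [cf|cf] := boolP (mnm_front c \in beta0); last first.
  by rewrite -(ext_front c) Ec PhiD Phi_front_out // mulmx0.
have wc : (w <= c ord_max)%N by move: nc; rewrite betaE cf /= -leqNgt.
(* Split off x_r^w as x_r times x_r^(w-1), the monomial on which [last_dir] reads the derivative of
   x_r. *)
have -> : c = ((mnm_ext (mnm_front c) (c ord_max - w)) + (U_(ord_max) + e (idx z0 (rev_ord s0))))%MM.
  rewrite thick_idxE ez0 [(U_(_) + _)%MM]addmC ext_addmax /= subn1 prednK //.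
  by apply: mnm_extP => [i|]; rewrite mnmDE ?mnm_ext_wd ?mnm_ext_max ?mnm0E ?addn0 ?mnmE // subnK.
rewrite PhiD PhiD rmonU Phi_basis P_delta S_out; last first.
  by rewrite thick_idxE ext_addmax mem_ext /= subn1 prednK // ltnn andbF.
rewrite (_ : tangentmx v ord_max *m _ = 0) ?col_mx0 ?mulmx0 //.
by rewrite -colE; apply/matrixP => a j; rewrite mxE -last_dirE v_last !mxE.
Qed.

(** The tangent homomorphism vanishes on all monomials outside beta. A variable times a basis
    monomial lies either in beta, where the derivative is normalized to 0, or outside. *)
Lemma tangent_inj : v = 0.
Proof.
suff A0 i b : tangentmx v i *m delta_mx b (0 : 'I_1) = 0.
  apply/rowP => u; rewrite [RHS]mxE -(enum_valK u); case: (enum_val u) => -[i a] b.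
  by have /matrixP/(_ a 0) := A0 i b; rewrite -colE !mxE.
have E : Phi (U_(i) + e b)%MM = col_mx (S i *m delta_mx b 0) (tangentmx v i *m delta_mx b 0).
  by rewrite PhiD rmonU Phi_basis P_delta.
have [bi|bi] := boolP ((U_(i) + e b)%MM \in beta); last first.
  by move: E; rewrite Phi_out // => /esym/eqP; rewrite col_mx_eq0 => /andP[_ /eqP].
have [c ec] := hb_monP bi; move: E; rewrite -ec Phi_basis => /eq_col_mx[_ <-].
by [].
Qed.

End Direction.

End Thickening.

(** Rank-nullity for one matrix of the list at a time, each costing at most t. *)
Lemma rank_joint_kernel (F : fieldType) r N q (V : 'M[F]_(r, N)) (Es : seq 'M[F]_(N, q)) t :
  (forall E, E \in Es -> (\rank (V *m E)%R <= t)%N) ->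
  exists V' : 'M[F]_N, [/\ (V' <= V)%MS, forall E, E \in Es -> (V' *m E = 0)%R
    & (\rank V <= size Es * t + \rank V')%N].
Proof.
elim: Es => [|E Es IH] Et; first by exists <<V>>%MS; rewrite genmxE submx_refl mxrank_gen.
have [|V' [V'V V'E le_V]] := IH; first by move=> E' E'Es; apply: Et; rewrite inE E'Es orbT.
exists (V' :&: kermx E)%MS; split.
- exact: submx_trans (capmxSl _ _) V'V.
- move=> E'; rewrite inE => /orP[/eqP ->|/V'E E'0]; first by apply/sub_kermxP/capmxSr.
  have /submxP[D ->] : (V' :&: kermx E <= V')%MS := capmxSl _ _.
  by rewrite -mulmxA E'0 mulmx0.
rewrite /= mulSn -(mxrank_mul_ker V' E) in le_V *.
apply: leq_trans le_V _; rewrite addnA leq_add2r addnC leq_add2r.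
by apply: leq_trans (Et E (mem_head _ _)); apply/mxrankS/submxMr.
Qed.

Lemma thick_tangent_dim_le (k : fieldType) (m : nat) (beta0 : {fset 'X_{1..m}}) (w : nat)
    (beta : {fset 'X_{1..m.+1}}) : basis_set beta0 -> (0 < w)%N ->
  (forall c, (c \in beta) = (mnm_front c \in beta0) && (c ord_max < w)%N) ->
  (tangent_dim (hb_equations k beta) (hb_point k beta) <=
   w * tangent_dim (hb_equations k beta0) (hb_point k beta0) + hb_n beta)%N.
Proof.
move=> B0 w0 betaE.
have [z0 ez0] : exists z0 : 'I_(hb_n beta0), hb_mon z0 = 0%MM.
  apply: hb_monP; have /fset0Pn[b bb] := B0.1.
  by apply: B0.2 bb _; apply/mnm_lepP => i; rewrite mnm0E.
rewrite /tangent_dim.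
set J := jacobian_at _ (hb_point k beta); set J0 := jacobian_at _ (hb_point k beta0).
rewrite -(mxrank_tr J) -(mxrank_tr J0) -!mxrank_ker.
pose Es := [seq sub_dir k w0 betaE s | s : 'I_w].
have [|V [VJ VE le_V]] := @rank_joint_kernel _ _ _ _ (kermx J^T) Es (\rank (kermx J0^T)).
  move=> E /mapP[s _ ->]; apply/mxrankS/sub_kermxP/row_matrixP => i.
  rewrite row0 row_mul (row_mul i (kermx J^T)); apply: (sub_dir_tangent B0 w0 betaE ez0).
  by rewrite /is_tangent -/J -(row_mul i (kermx J^T)) mulmx_ker row0.
apply: leq_trans le_V _; rewrite size_map -cardE card_ord leq_add2l.
(* On the joint kernel [last_dir] is injective, with values in a space of dimension [hb_n beta]. *)
rewrite -(mxrank_mul_ker V (last_dir k w0 betaE z0)).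
rewrite [X in (_ + X)%N](_ : _ = 0%N) ?addn0 ?rank_leq_col //.
apply/eqP; rewrite mxrank_eq0; apply/eqP/row_matrixP => i; rewrite row0.
set v := row i _.
have vV : (v <= V)%MS by apply: submx_trans (row_sub _ _) (capmxSl _ _).
apply: (tangent_inj B0 (w0 := w0) (betaE := betaE) ez0).
- by apply/sub_kermxP; apply: submx_trans vV VJ.
- move=> s; have /submxP[D ->] := vV; rewrite -mulmxA VE ?mulmx0 //.
  by apply: map_f; rewrite mem_enum.
by apply/sub_kermxP; apply: submx_trans (row_sub _ _) (capmxSr _ _).
Qed.

Local Open Scope fset_scope.

(* beta0 : basis set in x_1..x_m (m = r-1); beta : its thickening in x_1..x_{m+1},
   the last variable x_{m+1} = x_r being ord_max. *)
Theorem theorem6p3 (k : closedFieldType) (m : nat)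
    (beta0 : {fset 'X_{1..m}}) (w : nat) (beta : {fset 'X_{1..m.+1}}) :
  basis_set beta0 -> smooth_basis_set k beta0 -> (0 < w)%N ->
  (forall c : 'X_{1..m.+1},
     (c \in beta) = (mnm_front c \in beta0) && (c ord_max < w)%N) ->
  basis_set beta /\ smooth_basis_set k beta.
Proof.
move=> B0 sm0 w0 betaE; have B := thick_basis_set B0 w0 betaE; split=> //.
have zeroP r (b : {fset 'X_{1..r}}) : basis_set b -> exists z : 'I_(hb_n b), hb_mon z = 0%MM.
  move=> [/fset0Pn[c cb] b_closed]; apply: hb_monP; apply: b_closed cb _.
  by apply/mnm_lepP => i; rewrite mnm0E.
have [z ez] := zeroP _ _ B.
have t0_le : (tangent_dim (hb_equations k beta0) (hb_point k beta0) <= m * hb_n beta0)%N.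
  have [z0 ez0] := zeroP _ _ B0.
  (* Without variables the chart lies in affine space of dimension 0; otherwise some variable can
     serve as the generator x_i0. *)
  case: m beta0 beta B0 sm0 betaE {B z ez} z0 ez0 => [|m] beta0 beta B0 sm0 betaE z0 ez0.
    apply: leq_trans (leq_subr _ _) _.
    by rewrite /hb_N !card_prod card_ord !mul0n.
  exact: (smooth_tangent_dim_le ord0 ez0 B0.2 sm0).
have t_le : (tangent_dim (hb_equations k beta) (hb_point k beta) <= m.+1 * hb_n beta)%N.
  apply: leq_trans (thick_tangent_dim_le k B0 w0 betaE) _.
  rewrite mulSn addnC leq_add2l (thick_card betaE) mulnA [X in (_ <= X)%N]mulnC leq_mul2l.
  by rewrite t0_le orbT.
have chain := long_chain k ord0 ez B.2.
have no_longer d : prime_chain_at (hb_equations k beta) (hb_point k beta) d ->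
    (d <= tangent_dim (hb_equations k beta) (hb_point k beta))%N.
  by case=> c [c1 c2 c3 c4]; apply: chain_length_le c1 c2 c3 c4.
have Et : (tangent_dim (hb_equations k beta) (hb_point k beta) = m.+1 * hb_n beta)%N.
  by apply/eqP; rewrite eqn_leq t_le no_longer.
rewrite /smooth_basis_set /nonsingular_at /local_dim_is Et; split=> // /no_longer.
by rewrite Et ltnn.
Qed.
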